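(* Take $\alpha=\beta=1$. Let $s,l\in\mathbb{R}$ and let $D=H_0^{s,l}$ or $D=H^{s,l}$. On the infinite time interval $[0,\infty)$, the data-to-solution map $((u_0,n_0,n_1),\epsilon)\mapsto(u,n,\partial_tn)$, with domain extended from $D$ to $D\times[0,\infty)$ to include the parameter $\epsilon\in[0,\infty)$, and with solutions compared in the norm $\sup_{t\in[0,\infty)}\|\cdot\|_D$, fails to be continuous at any $\epsilon_0\ge0$. Indeed, for $N\in\mathbb{Z}\setminus\{0\}$ and data $(u_0,n_0,n_1)=(\langle N\rangle^{-s}e^{iNx},0,0)$, the triple $$(u,n,\partial_tn)(x,t)=(\langle N\rangle^{-s}e^{-it(N^2+\epsilon^2N^4)+iNx},0,0)$$ is the (classical) solution for the parameter $\epsilon\ge0$, and for all $\epsilon,\epsilon_0\ge0$ with $\epsilon\neq\epsilon_0$, $$\sup_{t\in[0,\infty)}\big\|\langle N\rangle^{-s}e^{-it(N^2+\epsilon^2N^4)+iNx}-\langle N\rangle^{-s}e^{-it(N^2+\epsilon_0^2N^4)+iNx}\big\|_{H^s_x}=\sup_{t\in[0,\infty)}|1-e^{it(\epsilon^2-\epsilon_0^2)N^4}|=2.$$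
   Context: $\mathbb{T}=\mathbb{R}/2\pi\mathbb{Z}$, $\langle x\rangle=(1+x^2)^{1/2}$. For $\epsilon\ge0$ (and $\alpha=\beta=1$) the system with parameter $\epsilon$ is $$(i\partial_t+\partial_{xx}-\epsilon^2\partial_{xx}^2)u=un,\qquad(\partial_{tt}-\partial_{xx}+\epsilon^2\partial_{xx}^2)n=\partial_{xx}(|u|^2),\qquad(u,n,\partial_tn)|_{t=0}=(u_0,n_0,n_1),$$ on $\mathbb{T}$, with $u$ complex-valued and $n$ real-valued. $H^{s,l}=H^s(\mathbb{T})\times H^l(\mathbb{T})\times H^{l-2}(\mathbb{T})$ and $H_0^{s,l}=H^s(\mathbb{T})\times H^l(\mathbb{T})\times H^{l-1}(\mathbb{T})$, normed by the sum of component norms, where $\|f\|_{H^s}=\|\langle k\rangle^s\hat f(k)\|_{l^2_k}$ and $\hat f(k)=\frac1{2\pi}\int f(x)e^{-ikx}dx$. *)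

(* Defs.v *)
From Stdlib Require Import Reals ZArith.
From Coquelicot Require Import Coquelicot.

(* Functions on T = R / 2 pi Z are 2 pi-periodic functions on R. *)

Open Scope R_scope.

Definition cis (theta : R) : C := (cos theta, sin theta).

Definition jb (k : Z) : R := sqrt (1 + (IZR k) ^ 2).

Definition periodic {V : Type} (f : R -> V) : Prop :=
  forall x, f (x + 2 * PI) = f x.

(* Total derivative of order j of a complex-valued function of a real
   variable; meaningful for functions satisfying [ex_CDerive_n]. *)
Definition CDerive_n (f : R -> C) (j : nat) (x : R) : C :=
  (Derive_n (fun y => Re (f y)) j x, Derive_n (fun y => Im (f y)) j x).

Definition ex_CDerive_n (f : R -> C) (j : nat) (x : R) : Prop :=
  ex_derive_n (fun y => Re (f y)) j x /\ ex_derive_n (fun y => Im (f y)) j x.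

Definition test_function (phi : R -> C) : Prop :=
  periodic phi /\ forall j x, ex_CDerive_n phi j x.

(* The values of a functional matter on test functions only; see [feq]. *)
Definition functional : Type := (R -> C) -> C.

(* Continuity for the usual topology of C^oo(T), whose seminorms are the
   suprema of the derivatives up to a given order. *)
Definition distribution (T : functional) : Prop :=
  (forall (a : C) (phi psi : R -> C), test_function phi -> test_function psi ->
     T (fun x => a * phi x + psi x)%C = (a * T phi + T psi)%C) /\
  (exists (m : nat) (M : R), forall phi, test_function phi ->
     forall B : R,
       (forall (j : nat) (x : R), (j <= m)%nat -> Cmod (CDerive_n phi j x) <= B) ->
       Cmod (T phi) <= M * B).

Definition real_valued (T : functional) : Prop :=
  forall phi, test_function phi -> T (fun x => Cconj (phi x)) = Cconj (T phi).

Definition feq (T S : functional) : Prop :=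
  forall phi, test_function phi -> T phi = S phi.

Definition fsub (T S : functional) : functional := fun phi => (T phi - S phi)%C.

(* The distribution defined by a (continuous) function on T. *)
Definition embed (f : R -> C) : functional :=
  fun phi => RInt (V := C_R_CompleteNormedModule)
                  (fun x => (f x * phi x)%C) 0 (2 * PI).

(* On [embed f] this is (1 / 2 pi) \int f(x) e^{-ikx} dx. *)
Definition hat (T : functional) (k : Z) : C :=
  (RtoC (/ (2 * PI)) * T (fun x => cis (- (IZR k * x))))%C.

Definition sobolev_coef (s : R) (T : functional) (k : Z) : R :=
  (Rpower (jb k) s * Cmod (hat T k)) ^ 2.

(* The sum over Z of nonnegative terms, arranged as a series over nat that
   groups k and -k. *)
Definition sobolev_term (s : R) (T : functional) (n : nat) : R :=
  match n with
  | O => sobolev_coef s T 0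
  | S _ => sobolev_coef s T (Z.of_nat n) + sobolev_coef s T (- Z.of_nat n)
  end.

Definition in_Hs (s : R) (T : functional) : Prop :=
  distribution T /\ ex_series (sobolev_term s T).

Definition Hs_norm (s : R) (T : functional) : R :=
  sqrt (Series (sobolev_term s T)).

Record state : Type := State { su : functional; sn : functional; sv : functional }.

Definition state_eq (d e : state) : Prop :=
  feq (su d) (su e) /\ feq (sn d) (sn e) /\ feq (sv d) (sv e).

Definition state_sub (d e : state) : state :=
  State (fsub (su d) (su e)) (fsub (sn d) (sn e)) (fsub (sv d) (sv e)).

Definition state_of (u : R -> C) (n v : R -> R) : state :=
  State (embed u) (embed (fun x => RtoC (n x))) (embed (fun x => RtoC (v x))).

Inductive data_space : Type :=
  | H0 (s l : R)
  | H (s l : R).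

Definition exponent_u (D : data_space) : R :=
  match D with H0 s _ => s | H s _ => s end.

Definition exponent_n (D : data_space) : R :=
  match D with H0 _ l => l | H _ l => l end.

Definition exponent_v (D : data_space) : R :=
  match D with H0 _ l => l - 1 | H _ l => l - 2 end.

Definition in_D (D : data_space) (d : state) : Prop :=
  in_Hs (exponent_u D) (su d) /\
  in_Hs (exponent_n D) (sn d) /\ real_valued (sn d) /\
  in_Hs (exponent_v D) (sv d) /\ real_valued (sv d).

Definition D_norm (D : data_space) (d : state) : R :=
  Hs_norm (exponent_u D) (su d) + Hs_norm (exponent_n D) (sn d) +
  Hs_norm (exponent_v D) (sv d).

(* v stands for the time derivative of n. *)
Record trajectory : Type :=
  Trajectory { tu : R -> R -> C; tn : R -> R -> R; tv : R -> R -> R }.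

(* Time derivative along [0, oo): one-sided at t = 0. *)
Definition is_tderive {V : NormedModule R_AbsRing} (f : R -> V) (t : R) (l : V) : Prop :=
  filterdiff f (within (fun tau => 0 <= tau) (locally t)) (fun h => scal h l).

(* Joint continuity on [0, oo) x R. *)
Definition cont_tx {V : UniformSpace} (f : R -> R -> V) : Prop :=
  forall t x, 0 <= t ->
    filterlim (fun p : R * R => f (fst p) (snd p))
      (within (fun p : R * R => 0 <= fst p) (locally (t, x)))
      (locally (f t x)).

Definition C_x (p : nat) (f : R -> R -> R) : Prop :=
  forall j, (j <= p)%nat ->
    (forall t x, 0 <= t -> ex_derive_n (f t) j x) /\
    cont_tx (fun t x => Derive_n (f t) j x).

(* Order in x of the system, which drops from 4 to 2 when epsilon = 0. *)
Definition xorder (eps : R) : nat := if Req_EM_T eps 0 then 2%nat else 4%nat.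

(* All derivatives occurring in the system exist, are continuous on
   [0, oo) x T, and satisfy the system pointwise. *)
Definition classical_solution (eps : R) (u0 : R -> C) (n0 n1 : R -> R)
    (z : trajectory) : Prop :=
  (forall t, 0 <= t -> periodic (tu z t) /\ periodic (tn z t) /\ periodic (tv z t)) /\
  C_x (xorder eps) (fun t x => Re (tu z t x)) /\
  C_x (xorder eps) (fun t x => Im (tu z t x)) /\
  C_x (xorder eps) (tn z) /\
  cont_tx (tv z) /\
  (forall t x, 0 <= t -> is_tderive (fun tau => tn z tau x) t (tv z t x)) /\
  (exists (ut : R -> R -> C) (vt : R -> R -> R),
     cont_tx (V := C_R_NormedModule) ut /\ cont_tx vt /\
     forall t x, 0 <= t ->
       is_tderive (V := C_R_NormedModule) (fun tau => tu z tau x) t (ut t x) /\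
       is_tderive (fun tau => tv z tau x) t (vt t x) /\
       (Ci * ut t x + CDerive_n (tu z t) 2 x
          - RtoC (eps ^ 2) * CDerive_n (tu z t) 4 x
        = tu z t x * RtoC (tn z t x))%C /\
       vt t x - Derive_n (tn z t) 2 x + eps ^ 2 * Derive_n (tn z t) 4 x
        = Derive_n (fun y => (Cmod (tu z t y)) ^ 2) 2 x) /\
  (forall x, tu z 0 x = u0 x /\ tn z 0 x = n0 x /\ tv z 0 x = n1 x).

Definition is_the_classical_solution (eps : R) (u0 : R -> C) (n0 n1 : R -> R)
    (z : trajectory) : Prop :=
  classical_solution eps u0 n0 n1 z /\
  forall z', classical_solution eps u0 n0 n1 z' ->
    forall t x, 0 <= t ->
      tu z' t x = tu z t x /\ tn z' t x = tn z t x /\ tv z' t x = tv z t x.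

Definition traj_state (z : trajectory) (t : R) : state :=
  state_of (tu z t) (tn z t) (tv z t).

(* Phi d eps t is the value at time t of the solution with data d and
   parameter eps. The only requirement is agreement with the classical solution
   whenever there is exactly one and it stays in D; rougher data are left
   unconstrained, so that any notion of weak solution is covered. *)
Definition data_to_solution_map (D : data_space)
    (Phi : state -> R -> R -> state) : Prop :=
  (forall d eps t, in_D D d -> 0 <= eps -> 0 <= t -> in_D D (Phi d eps t)) /\
  (forall d eps u0 n0 n1 z, in_D D d -> 0 <= eps ->
     state_eq d (state_of u0 n0 n1) ->
     is_the_classical_solution eps u0 n0 n1 z ->
     (forall t, 0 <= t -> in_D D (traj_state z t)) ->
     forall t, 0 <= t -> state_eq (Phi d eps t) (traj_state z t)).

Definition sup_time (f : R -> R) : Rbar :=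
  Lub_Rbar (fun r => exists t, 0 <= t /\ r = f t).

Definition continuous_at (D : data_space) (Phi : state -> R -> R -> state)
    (d0 : state) (eps0 : R) : Prop :=
  forall eta, 0 < eta -> exists delta, 0 < delta /\
    forall d eps, in_D D d -> 0 <= eps ->
      D_norm D (state_sub d d0) < delta -> Rabs (eps - eps0) < delta ->
      Rbar_lt (sup_time (fun t => D_norm D (state_sub (Phi d eps t) (Phi d0 eps0 t))))
              eta.

Definition plane_u0 (s : R) (N : Z) (x : R) : C :=
  (RtoC (Rpower (jb N) (- s)) * cis (IZR N * x))%C.

Definition plane_u (s eps : R) (N : Z) (t x : R) : C :=
  (RtoC (Rpower (jb N) (- s)) *
   cis (- t * (IZR N ^ 2 + eps ^ 2 * IZR N ^ 4) + IZR N * x))%C.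

Definition plane_wave (s eps : R) (N : Z) : trajectory :=
  Trajectory (plane_u s eps N) (fun _ _ => 0) (fun _ _ => 0).

Definition plane_data (s : R) (N : Z) : state :=
  state_of (plane_u0 s N) (fun _ => 0) (fun _ => 0).

(* Main.v *)
Require Import Defs.
From Stdlib Require Import Reals ZArith.
From Coquelicot Require Import Coquelicot.
From Stdlib Require Import Lra Lia.
Open Scope R_scope.

(** The discontinuity comes from a phase. A plane wave of wave number N rotates
    with the frequency [dispersion eps N], so two such waves with the same data
    and different eps drift apart until, at a finite time, they are opposite;
    since the weight [<N>^s] of the norm and the amplitude [<N>^-s] cancel, their
    distance is then 2, however close the parameters are
    ([plane_coef_distance], [sup_relative_phase]).

    A data-to-solution map is only constrained at data with exactly one classical
    solution, so the substance of the proof is that the plane wave is the only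
    classical solution with its data ([plane_wave_unique]). A direct energy
    estimate for the difference of two solutions loses a derivative in the
    wave equation. Conservation laws avoid this. Write a + ib for the Schroedinger
    component, U + iV for the wave, c + id for their difference,
    [L = - d_xx + eps^2 d_xx^2], omega for the frequency and m for the constant
    [U^2 + V^2]. The wave equation is the system [n_t = q_xx],
    [q_t = n - eps^2 n_xx + a^2 + b^2 - m], where q is a time integral. The wave is
    a critical point of the energy minus omega times the mass, and up to a constant
    this conserved quantity equals the integral of
    [c L c + d L d - omega (c^2 + d^2) + n (a^2 + b^2 - m)
     + (n^2 + eps^2 n_x^2 + q_x^2) / 2].
    It vanishes at time 0, hence always. Since [a^2 + b^2 - m] is bounded by a
    constant times [|c| + |d|], it follows that the integral of [n^2] is at
    most a constant times that of [c^2 + d^2]. The time derivative of the latter is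
    the integral of [2 n (V c - U d)], so Gronwall's inequality closes
    ([real_solution_unique]).

    The regularity of a classical solution does not allow the energy to be
    differentiated under the integral sign, because [L c] need not have a time
    derivative; [is_derive_symmetric_pairing] differentiates it all the same. *)

(** * Jointly continuous functions of time and space *)

Definition cont1 (f : R -> R) : Prop := forall x, continuous f x.

Definition cont2 (f : R -> R -> R) : Prop := forall t x, continuity_2d_pt f t x.

Definition circle_int (f : R -> R) : R := RInt f 0 (2 * PI).

Lemma cont1_const c : cont1 (fun _ => c).
Proof. intros x; apply continuous_const. Qed.

Lemma cont1_plus f g : cont1 f -> cont1 g -> cont1 (fun x => f x + g x).
Proof. intros Hf Hg x; apply (continuous_plus (V := R_NormedModule) f g); auto. Qed.

Lemma cont1_opp f : cont1 f -> cont1 (fun x => - f x).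
Proof. intros Hf x; apply (continuous_opp (V := R_NormedModule) f); auto. Qed.

Lemma cont1_minus f g : cont1 f -> cont1 g -> cont1 (fun x => f x - g x).
Proof. intros Hf Hg x; apply (continuous_minus (V := R_NormedModule) f g); auto. Qed.

Lemma cont1_mult f g : cont1 f -> cont1 g -> cont1 (fun x => f x * g x).
Proof. intros Hf Hg x; apply (continuous_mult (K := R_AbsRing) f g); auto. Qed.

Lemma cont1_ext f g : (forall x, f x = g x) -> cont1 f -> cont1 g.
Proof. intros E Hf x; apply (continuous_ext f); auto. Qed.

Lemma cont1_is_derive f f' : (forall x, is_derive f x (f' x)) -> cont1 f.
Proof. intros H x; apply (ex_derive_continuous (V := R_NormedModule) f x); eexists; apply H. Qed.

Lemma cont2_const c : cont2 (fun _ _ => c).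
Proof. intros t x; apply continuity_2d_pt_const. Qed.

Lemma cont2_plus f g : cont2 f -> cont2 g -> cont2 (fun t x => f t x + g t x).
Proof. intros Hf Hg t x; apply continuity_2d_pt_plus; auto. Qed.

Lemma cont2_opp f : cont2 f -> cont2 (fun t x => - f t x).
Proof. intros Hf t x; apply continuity_2d_pt_opp; auto. Qed.

Lemma cont2_minus f g : cont2 f -> cont2 g -> cont2 (fun t x => f t x - g t x).
Proof. intros Hf Hg t x; apply continuity_2d_pt_minus; auto. Qed.

Lemma cont2_mult f g : cont2 f -> cont2 g -> cont2 (fun t x => f t x * g t x).
Proof. intros Hf Hg t x; apply continuity_2d_pt_mult; auto. Qed.

Lemma cont2_ext f g : (forall t x, f t x = g t x) -> cont2 f -> cont2 g.
Proof. intros E Hf t x; apply (continuity_2d_pt_ext f); auto. Qed.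

Lemma cont2_comp (h : R -> R) f : cont1 h -> cont2 f -> cont2 (fun t x => h (f t x)).
Proof.
  intros Hh Hf t x; apply continuity_1d_2d_pt_comp; auto.
  apply continuity_pt_filterlim, Hh.
Qed.

Lemma cont2_time (h : R -> R) : cont1 h -> cont2 (fun t _ => h t).
Proof. intros Hh; apply cont2_comp; auto; intros t x; apply continuity_2d_pt_id1. Qed.

Lemma cont2_space (h : R -> R) : cont1 h -> cont2 (fun _ x => h x).
Proof. intros Hh; apply cont2_comp; auto; intros t x; apply continuity_2d_pt_id2. Qed.

Lemma cont2_swap f : cont2 f -> cont2 (fun x t => f t x).
Proof.
  intros Hf x t eps; destruct (Hf t x eps) as [d Hd].
  exists d; intros u v Hu Hv; apply Hd; auto.
Qed.

Lemma cont2_row f t : cont2 f -> cont1 (f t).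
Proof.
  intros Hf x; apply continuity_pt_filterlim.
  intros eps Heps; destruct (Hf t x (mkposreal eps Heps)) as [d Hd].
  exists d; split; [apply cond_pos|].
  intros y [_ Hy]; apply Hd; auto.
  rewrite Rminus_diag, Rabs_R0; apply cond_pos.
Qed.

Lemma cont2_col f x : cont2 f -> cont1 (fun t => f t x).
Proof. intros Hf; apply (cont2_row (fun x t => f t x)), cont2_swap, Hf. Qed.

Create HintDb cont.
#[export] Hint Resolve cont1_const cont1_plus cont1_minus cont1_mult cont1_opp
  cont2_const cont2_plus cont2_minus cont2_mult cont2_opp cont2_row cont2_col : cont.
Ltac cont := auto 20 with cont.

(** On a rectangle, walk from a corner in steps shorter than the modulus of
    uniform continuity: each step changes the function by less than one. *)
Lemma cont2_bounded f T X : cont2 f -> 0 <= T -> 0 <= X ->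
  exists B, 0 < B /\ forall t x, 0 <= t <= T -> 0 <= x <= X -> Rabs (f t x) <= B.
Proof.
  intros Hf HT HX.
  destruct (uniform_continuity_2d f 0 T 0 X (fun t x _ _ => Hf t x)
              (mkposreal 1 Rlt_0_1)) as [d Hd]; simpl in Hd.
  assert (Hdp := cond_pos d).
  destruct (INR_unbounded ((T + X) / d)) as [n Hn].
  assert (HTX : 0 <= (T + X) / d) by (apply Rcomplements.Rdiv_le_0_compat; lra).
  assert (Hn0 : 0 < INR n) by lra.
  assert (Hstep : (T + X) / INR n < d).
  { apply Rcomplements.Rlt_div_l; auto.
    apply Rcomplements.Rlt_div_l in Hn; auto. lra. }
  exists (Rabs (f 0 0) + INR n + 1); split.
  { assert (H := Rabs_pos (f 0 0)); lra. }
  intros t x Ht Hx.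
  assert (Hk : forall k, (k <= n)%nat ->
    Rabs (f (INR k * (t / INR n)) (INR k * (x / INR n)))
      <= Rabs (f 0 0) + INR k).
  { assert (Htn : 0 <= t / INR n) by (apply Rcomplements.Rdiv_le_0_compat; lra).
    assert (Hxn : 0 <= x / INR n) by (apply Rcomplements.Rdiv_le_0_compat; lra).
    assert (Hin : forall k z Z, (k <= n)%nat -> 0 <= z <= Z ->
              0 <= z / INR n -> 0 <= INR k * (z / INR n) <= Z).
    { intros k z Z Hkn Hz Hzn; split; [apply Rmult_le_pos; auto; apply pos_INR|].
      apply Rle_trans with (INR n * (z / INR n)).
      - apply Rmult_le_compat_r; auto; apply le_INR; auto.
      - replace (INR n * (z / INR n)) with z by (field; lra); lra. }
    assert (Hz : forall z Z, 0 <= z <= Z -> Z <= T + X -> Rabs (z / INR n) < d).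
    { intros z Z Hz HZ. rewrite Rabs_pos_eq.
      2: apply Rcomplements.Rdiv_le_0_compat; lra.
      apply Rle_lt_trans with (2 := Hstep).
      apply Rmult_le_compat_r; [left; apply Rinv_0_lt_compat; auto|lra]. }
    induction k as [|k IH]; intros Hkn.
    - simpl INR; rewrite !Rmult_0_l; lra.
    - rewrite S_INR; specialize (IH ltac:(lia)).
      assert (H : Rabs (f (INR (S k) * (t / INR n)) (INR (S k) * (x / INR n))
                  - f (INR k * (t / INR n)) (INR k * (x / INR n))) < 1).
      { apply Hd.
        - apply Hin; auto; lia.
        - apply Hin; auto; lia.
        - apply Hin; auto.
        - apply Hin; auto.
        - rewrite S_INR.
          replace ((INR k + 1) * (t / INR n) - INR k * (t / INR n)) with (t / INR n) by ring.
          apply Hz with T; lra.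
        - rewrite S_INR.
          replace ((INR k + 1) * (x / INR n) - INR k * (x / INR n)) with (x / INR n) by ring.
          apply Hz with X; lra. }
      rewrite S_INR in H.
      assert (H' := Rabs_triang_inv (f ((INR k + 1) * (t / INR n)) ((INR k + 1) * (x / INR n)))
                     (f (INR k * (t / INR n)) (INR k * (x / INR n)))).
      lra. }
  specialize (Hk n (le_n n)).
  replace (INR n * (t / INR n)) with t in Hk by (field; lra).
  replace (INR n * (x / INR n)) with x in Hk by (field; lra).
  lra.
Qed.

(** * Integrals over the circle *)

Lemma two_pi_pos : 0 < 2 * PI.
Proof. assert (H := PI_RGT_0); lra. Qed.

Lemma ex_circle f : cont1 f -> ex_RInt f 0 (2 * PI).
Proof. intros Hf; apply (ex_RInt_continuous (V := R_CompleteNormedModule)); intros x _; apply Hf. Qed.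

Lemma circle_ext f g : (forall x, f x = g x) -> circle_int f = circle_int g.
Proof. intros E; apply RInt_ext; auto. Qed.

Lemma circle_plus f g : cont1 f -> cont1 g ->
  circle_int (fun x => f x + g x) = circle_int f + circle_int g.
Proof. intros; apply (RInt_plus f g); apply ex_circle; auto. Qed.

Lemma circle_minus f g : cont1 f -> cont1 g ->
  circle_int (fun x => f x - g x) = circle_int f - circle_int g.
Proof. intros; apply (RInt_minus f g); apply ex_circle; auto. Qed.

Lemma circle_scal c f : cont1 f -> circle_int (fun x => c * f x) = c * circle_int f.
Proof. intros; apply (RInt_scal f); apply ex_circle; auto. Qed.

Lemma circle_le f g : cont1 f -> cont1 g -> (forall x, 0 < x < 2 * PI -> f x <= g x) ->
  circle_int f <= circle_int g.
Proof.
  intros; apply RInt_le; auto using ex_circle.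
  assert (Hp := two_pi_pos); lra.
Qed.

Lemma circle_zero : circle_int (fun _ => 0) = 0.
Proof. unfold circle_int; rewrite RInt_const; apply Rmult_0_r. Qed.

Lemma circle_nonneg f : cont1 f -> (forall x, 0 <= f x) -> 0 <= circle_int f.
Proof. intros; rewrite <- circle_zero; apply circle_le; cont. Qed.

(** A positive value persists on an interval, where the integral is positive. *)
Lemma circle_zero_inv f : cont1 f -> (forall x, 0 <= f x) -> circle_int f <= 0 ->
  forall x, 0 <= x <= 2 * PI -> f x = 0.
Proof.
  intros Hf Hpos Hint x Hx.
  assert (Hp := two_pi_pos).
  destruct (Rle_lt_or_eq_dec _ _ (Hpos x)) as [Hfx|]; auto; exfalso.
  assert (Hc := proj2 (continuity_pt_filterlim f x) (Hf x)).
  destruct (Hc (f x) Hfx) as [d [Hd Hnear]].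
  assert (Hloc : forall y, Rabs (y - x) < d -> 0 < f y).
  { intros y Hy. destruct (Req_dec x y) as [->|Hxy]; auto.
    assert (H : Rabs (f y - f x) < f x).
    { apply Hnear; split; auto. split; auto. exact I. }
    apply Rabs_def2 in H; lra. }
  set (lo := Rmax 0 (x - d / 2)). set (hi := Rmin (2 * PI) (x + d / 2)).
  assert (Hlo : 0 <= lo /\ x - d / 2 <= lo) by (split; [apply Rmax_l|apply Rmax_r]).
  assert (Hhi : hi <= 2 * PI /\ hi <= x + d / 2) by (split; [apply Rmin_l|apply Rmin_r]).
  assert (Hlh : lo < hi).
  { unfold lo, hi; apply Rmax_lub_lt; apply Rmin_glb_lt; lra. }
  assert (H1 : 0 < RInt f lo hi).
  { apply RInt_gt_0; auto. intros y Hy; apply Hloc; apply Rabs_def1; lra. }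
  assert (Hex : forall u v, ex_RInt f u v)
    by (intros; apply (ex_RInt_continuous (V := R_CompleteNormedModule)); intros; apply Hf).
  assert (Hge : forall u v, u <= v -> 0 <= RInt f u v)
    by (intros; apply RInt_ge_0; auto).
  assert (E1 := RInt_Chasles f 0 lo (2 * PI) (Hex _ _) (Hex _ _)).
  assert (E2 := RInt_Chasles f lo hi (2 * PI) (Hex _ _) (Hex _ _)).
  assert (G1 := Hge 0 lo ltac:(lra)). assert (G2 := Hge hi (2 * PI) ltac:(lra)).
  unfold circle_int in Hint. unfold plus in E1, E2; simpl in E1, E2. lra.
Qed.

Lemma is_derive_Rmult (f g : R -> R) x df dg : is_derive f x df -> is_derive g x dg ->
  is_derive (fun y => f y * g y) x (df * g x + f x * dg).
Proof. rewrite !is_derive_Reals; apply derivable_pt_lim_mult. Qed.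

(** Integration by parts; the boundary terms cancel by periodicity. *)
Lemma circle_by_parts f g f' g' :
  periodic f -> periodic g ->
  (forall x, is_derive f x (f' x)) -> (forall x, is_derive g x (g' x)) ->
  cont1 f' -> cont1 g' ->
  circle_int (fun x => f' x * g x) = - circle_int (fun x => f x * g' x).
Proof.
  intros Pf Pg Df Dg Cf Cg.
  assert (cont1 f) by (eapply cont1_is_derive; eauto).
  assert (cont1 g) by (eapply cont1_is_derive; eauto).
  assert (E : circle_int (fun x => f' x * g x + f x * g' x) = 0).
  { apply is_RInt_unique.
    replace 0 with (minus (f (2 * PI) * g (2 * PI)) (f 0 * g 0)) at 2.
    - apply (is_RInt_derive (V := R_CompleteNormedModule) (fun x => f x * g x)).
      + intros x _; apply is_derive_Rmult; auto.
      + intros x _; apply cont1_plus; cont.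
    - assert (Ef := Pf 0); assert (Eg := Pg 0); rewrite Rplus_0_l in Ef, Eg.
      rewrite Ef, Eg; apply Rminus_diag. }
  rewrite circle_plus in E; cont; lra.
Qed.

(** * Differentiation of integrals *)

Lemma is_derive_RInt_row (f df : R -> R -> R) (a b y : R) :
  locally y (fun u => forall t, is_derive (fun z => f z t) u (df u t)) ->
  cont2 f -> cont2 df ->
  is_derive (fun u => RInt (f u) a b) y (RInt (df y) a b).
Proof.
  intros Hd Cf Cdf.
  assert (Hy : forall t, Derive (fun u => f u t) y = df y t).
  { intros t; apply is_derive_unique; apply (locally_singleton _ _ Hd). }
  rewrite <- (RInt_ext (fun t => Derive (fun u => f u t) y)) by (intros; apply Hy).
  apply is_derive_RInt_param.
  - apply filter_imp with (2 := Hd); intros u Hu t _; eexists; apply Hu.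
  - intros t _. apply (continuity_2d_pt_ext_loc df); auto.
    destruct Hd as [d Hd]; exists d; intros u v Hu _; symmetry.
    apply is_derive_unique, Hd, Hu.
  - apply filter_forall; intros u; apply (ex_RInt_continuous (V := R_CompleteNormedModule)); intros; apply cont2_row, Cf.
Qed.

Lemma locally_pos t : 0 < t -> locally t (fun s => 0 < s).
Proof. intros Ht; apply (open_gt 0 t Ht). Qed.

Lemma is_derive_circle (f df : R -> R -> R) t : 0 < t ->
  (forall s x, 0 < s -> is_derive (fun z => f z x) s (df s x)) ->
  cont2 f -> cont2 df ->
  is_derive (fun s => circle_int (f s)) t (circle_int (df t)).
Proof.
  intros Ht Hd Cf Cdf; apply is_derive_RInt_row; auto.
  apply filter_imp with (2 := locally_pos t Ht); intros; auto.
Qed.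

Lemma cont1_circle f : cont2 f -> cont1 (fun t => circle_int (f t)).
Proof.
  intros Hf t; apply continuity_pt_filterlim; intros eps Heps.
  assert (Hp := two_pi_pos).
  assert (He : 0 < eps / (2 * (2 * PI))) by (apply Rdiv_lt_0_compat; lra).
  destruct (uniform_continuity_2d_1d' f 0 (2 * PI) t (fun x _ => Hf t x)
              (mkposreal _ He)) as [d Hd]; simpl in Hd.
  exists d; split; [apply cond_pos|]; intros s [_ Hs].
  change (Rabs (circle_int (f s) - circle_int (f t)) < eps).
  change (Rabs (s - t) < d) in Hs.
  rewrite <- circle_minus; cont.
  apply Rle_lt_trans with ((2 * PI - 0) * (eps / (2 * (2 * PI)))).
  - apply abs_RInt_le_const; [lra|apply ex_circle; cont|].
    intros x Hx; left; apply Hd; auto.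
    + assert (H := cond_pos d); lra.
    + apply Rabs_def2 in Hs; lra.
    + rewrite Rminus_diag, Rabs_R0; apply cond_pos.
  - replace ((2 * PI - 0) * (eps / (2 * (2 * PI)))) with (eps / 2) by (field; lra); lra.
Qed.

(** A symmetric pairing of [A t] with [w t] is differentiated by differentiating
    [w] alone, because its increment is the pairing of [A s + A t] with
    [w s - w t]. With [A = L w] and L a differential operator in x, the energy
    of w has a time derivative although [L w] need not have one. *)
Lemma is_derive_symmetric_pairing (A w dw : R -> R -> R) t : 0 < t ->
  cont2 A -> cont2 w -> cont2 dw ->
  (forall s x, 0 < s -> is_derive (fun z => w z x) s (dw s x)) ->
  (forall r s, 0 < r -> 0 < s ->
     circle_int (fun x => A r x * w s x) = circle_int (fun x => A s x * w r x)) ->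
  is_derive (fun s => circle_int (fun x => A s x * w s x)) t
    (circle_int (fun x => 2 * (A t x * dw t x))).
Proof.
  intros Ht CA Cw Cdw Hd Hsym; apply is_derive_Reals; intros eps Heps.
  assert (Hp := two_pi_pos).
  destruct (cont2_bounded (fun s x => A t x) 0 (2 * PI)) as [B1 [HB1 HA]];
    [apply cont2_space; cont|lra|lra|].
  destruct (cont2_bounded (fun s x => dw t x) 0 (2 * PI)) as [B2 [HB2 HB]];
    [apply cont2_space; cont|lra|lra|].
  set (eta := Rmin 1 (eps / (2 * (2 * PI) * (B2 + 1 + 2 * B1)))).
  assert (HK : 0 < 2 * (2 * PI) * (B2 + 1 + 2 * B1)) by (apply Rmult_lt_0_compat; lra).
  assert (Heta : 0 < eta) by (apply Rmin_pos; [lra|apply Rdiv_lt_0_compat; lra]).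
  assert (Heta1 : eta <= 1) by apply Rmin_l.
  assert (Heta2 : eta * (2 * (2 * PI) * (B2 + 1 + 2 * B1)) <= eps).
  { apply Rcomplements.Rle_div_r; auto; apply Rmin_r. }
  destruct (uniform_continuity_2d_1d' A 0 (2 * PI) t (fun x _ => CA t x)
              (mkposreal _ Heta)) as [d1 Hd1]; simpl in Hd1.
  destruct (uniform_continuity_2d_1d' dw 0 (2 * PI) t (fun x _ => Cdw t x)
              (mkposreal _ Heta)) as [d2 Hd2]; simpl in Hd2.
  assert (P1 := cond_pos d1); assert (P2 := cond_pos d2).
  assert (Hdelta : 0 < Rmin t (Rmin d1 d2)) by (repeat apply Rmin_pos; auto).
  exists (mkposreal _ Hdelta); simpl; intros h Hh0 Hh.
  assert (Hht : Rabs h < t) by (eapply Rlt_le_trans; [exact Hh|apply Rmin_l]).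
  assert (Hhd : Rabs h < Rmin d1 d2) by (eapply Rlt_le_trans; [exact Hh|apply Rmin_r]).
  assert (Hhd1 : Rabs h < d1) by (eapply Rlt_le_trans; [exact Hhd|apply Rmin_l]).
  assert (Hhd2 : Rabs h < d2) by (eapply Rlt_le_trans; [exact Hhd|apply Rmin_r]).
  apply Rabs_def2 in Hht; apply Rabs_def2 in Hhd1; apply Rabs_def2 in Hhd2.
  replace ((circle_int (fun x => A (t + h) x * w (t + h) x)
            - circle_int (fun x => A t x * w t x)) / h
           - circle_int (fun x => 2 * (A t x * dw t x)))
    with (circle_int (fun x => (A (t + h) x + A t x) * (/ h * (w (t + h) x - w t x))
                               - 2 * (A t x * dw t x))).
  2:{ rewrite circle_minus; cont; f_equal.
      rewrite (circle_ext _ (fun x => / h * ((A (t + h) x * w (t + h) x - A t x * w t x)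
          + (A t x * w (t + h) x - A (t + h) x * w t x)))) by (intros; ring).
      rewrite circle_scal, circle_plus, !circle_minus, (Hsym t (t + h)); cont; lra. }
  apply Rle_lt_trans with ((2 * PI - 0) * (eta * (B2 + 1 + 2 * B1))).
  2:{ apply Rlt_le_trans with (2 := Heta2).
      assert (H : 0 < eta * (B2 + 1 + 2 * B1)) by (apply Rmult_lt_0_compat; lra).
      assert (H' := Rmult_lt_0_compat _ _ Hp H). lra. }
  apply abs_RInt_le_const; [lra|apply ex_circle; cont|].
  intros x Hx.
  (* The difference quotient is a value of the time derivative nearby. *)
  assert (Hm : exists xi, Rabs (xi - t) <= Rabs h /\ / h * (w (t + h) x - w t x) = dw xi x).
  { destruct (MVT_gen (fun s => w s x) t (t + h) (fun s => dw s x)) as [xi [Hxi E]].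
    - intros s Hs; apply Hd. revert Hs; unfold Rmin, Rmax.
      destruct (Rle_dec t (t + h)); intros; lra.
    - intros s _; apply continuity_pt_filterlim; apply (cont2_col w x Cw).
    - exists xi; split.
      + revert Hxi; unfold Rmin, Rmax; destruct (Rle_dec t (t + h)); intros;
          unfold Rabs; destruct (Rcase_abs (xi - t)), (Rcase_abs h); lra.
      + rewrite E; field; auto. }
  destruct Hm as [xi [Hxi ->]].
  assert (Hxi' : xi - t < d2 /\ - d2 < xi - t).
  { apply Rabs_def2; apply Rle_lt_trans with (1 := Hxi); apply Rabs_def1; lra. }
  assert (F1 : Rabs (A (t + h) x - A t x) < eta).
  { apply Hd1; try lra. rewrite Rminus_diag, Rabs_R0; auto. }
  assert (F2 : Rabs (dw xi x - dw t x) < eta).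
  { apply Hd2; try lra. rewrite Rminus_diag, Rabs_R0; auto. }
  assert (F3 := HA 0 x ltac:(lra) Hx); assert (F4 := HB 0 x ltac:(lra) Hx); simpl in F3, F4.
  replace ((A (t + h) x + A t x) * dw xi x - 2 * (A t x * dw t x))
    with ((A (t + h) x - A t x) * ((dw xi x - dw t x) + dw t x)
          + 2 * A t x * (dw xi x - dw t x)) by ring.
  eapply Rle_trans; [apply Rabs_triang|].
  rewrite !Rabs_mult, (Rabs_pos_eq 2) by lra.
  assert (F5 := Rabs_triang (dw xi x - dw t x) (dw t x)).
  assert (G1 : Rabs (A (t + h) x - A t x) * Rabs (dw xi x - dw t x + dw t x) <= eta * (1 + B2)).
  { apply Rmult_le_compat; try apply Rabs_pos; lra. }
  assert (G2 : Rabs (A t x) * Rabs (dw xi x - dw t x) <= B1 * eta).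
  { apply Rmult_le_compat; try apply Rabs_pos; lra. }
  lra.
Qed.

Lemma constant_of_is_derive_zero (f : R -> R) : cont1 f ->
  (forall t, 0 < t -> is_derive f t 0) -> forall t, 0 <= t -> f t = f 0.
Proof.
  intros Cf Hd t Ht.
  destruct (MVT_gen f 0 t (fun _ => 0)) as [xi [_ E]].
  - intros s Hs; apply Hd; rewrite Rmin_left in Hs; lra.
  - intros s _; apply continuity_pt_filterlim, Cf.
  - lra.
Qed.

Lemma gronwall_zero (f df : R -> R) C T : 0 <= T -> cont1 f ->
  (forall t, 0 <= t -> 0 <= f t) -> f 0 = 0 ->
  (forall t, 0 < t -> is_derive f t (df t)) ->
  (forall t, 0 <= t <= T -> df t <= C * f t) -> f T = 0.
Proof.
  intros HT Cf Hpos H0 Hd Hle.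
  destruct (MVT_gen (fun t => exp (- (C * t)) * f t) 0 T
     (fun t => exp (- (C * t)) * (df t - C * f t))) as [xi [Hxi E]].
  - intros s Hs; rewrite Rmin_left in Hs by lra.
    replace (exp (- (C * s)) * (df s - C * f s))
      with (- C * exp (- (C * s)) * f s + exp (- (C * s)) * df s) by ring.
    apply (is_derive_Rmult (fun t => exp (- (C * t))) f); [auto_derive; auto; ring|apply Hd; lra].
  - intros s _; apply continuity_pt_filterlim.
    apply (cont1_mult (fun t => exp (- (C * t))) f); auto.
    intros u; apply (ex_derive_continuous (fun t => exp (- (C * t)))); auto_derive; auto.
  - rewrite Rmin_left, Rmax_right in Hxi by lra.
    assert (F := Hle xi Hxi).
    assert (Ex := exp_pos (- (C * xi))); assert (ET := exp_pos (- (C * T))).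
    assert (G : exp (- (C * T)) * f T <= 0).
    { rewrite H0 in E. assert (exp (- (C * xi)) * (df xi - C * f xi) <= 0) by nra. nra. }
    assert (P := Hpos T HT). nra.
Qed.

(** * The spatial operator *)

Definition smooth (p : nat) (f : R -> R) : Prop :=
  periodic f /\
  forall j x, (j <= p)%nat -> ex_derive_n f j x /\ continuous (Derive_n f j) x.

Definition ell (eps : R) (f : R -> R) (x : R) : R :=
  - Derive_n f 2 x + eps ^ 2 * Derive_n f 4 x.

Lemma periodic_Derive_n f j : periodic f -> periodic (Derive_n f j).
Proof.
  intros Hf x. rewrite <- Derive_n_comp_trans.
  apply Derive_n_ext; intros; apply Hf.
Qed.

Lemma smooth_is_derive p f j : smooth p f -> (j < p)%nat ->
  forall x, is_derive (Derive_n f j) x (Derive_n f (S j) x).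
Proof.
  intros [_ Hf] Hj x. apply Derive_correct.
  apply (proj1 (Hf (S j) x ltac:(lia))).
Qed.

Lemma smooth_cont p f j : smooth p f -> (j <= p)%nat -> cont1 (Derive_n f j).
Proof. intros [_ Hf] Hj x; apply Hf, Hj. Qed.

Lemma smooth_minus_n p f g j : smooth p f -> smooth p g -> (j <= p)%nat ->
  forall x, Derive_n (fun y => f y - g y) j x = Derive_n f j x - Derive_n g j x.
Proof.
  intros [_ Hf] [_ Hg] Hj x; apply Derive_n_minus;
    apply filter_forall; intros y k Hk; [apply Hf|apply Hg]; lia.
Qed.

Lemma smooth_minus p f g : smooth p f -> smooth p g -> smooth p (fun y => f y - g y).
Proof.
  intros Hf Hg; split.
  - intros x; rewrite (proj1 Hf x), (proj1 Hg x); reflexivity.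
  - intros j x Hj; split.
    + apply ex_derive_n_minus; apply filter_forall; intros y k Hk;
        [apply (proj2 Hf)|apply (proj2 Hg)]; lia.
    + apply cont1_ext with (fun y => Derive_n f j y - Derive_n g j y).
      * intros y; symmetry; apply (smooth_minus_n p); auto.
      * apply cont1_minus; eapply smooth_cont; eauto.
Qed.

Lemma xorder_ge2 eps : (2 <= xorder eps)%nat.
Proof. unfold xorder; destruct (Req_EM_T eps 0); lia. Qed.

Lemma xorder_cases eps : eps = 0 \/ xorder eps = 4%nat.
Proof. unfold xorder; destruct (Req_EM_T eps 0); auto. Qed.

Lemma ell_minus eps f g : smooth (xorder eps) f -> smooth (xorder eps) g ->
  forall x, ell eps (fun y => f y - g y) x = ell eps f x - ell eps g x.
Proof.
  intros Hf Hg x; unfold ell; assert (H2 := xorder_ge2 eps).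
  rewrite (smooth_minus_n (xorder eps) f g 2) by auto.
  destruct (xorder_cases eps) as [->|E]; [ring|].
  rewrite (smooth_minus_n (xorder eps) f g 4) by (auto; lia). ring.
Qed.

Lemma circle_shift_derivative p f g i j : smooth p f -> smooth p g ->
  (i < p)%nat -> (j < p)%nat ->
  circle_int (fun x => Derive_n f (S i) x * Derive_n g j x)
  = - circle_int (fun x => Derive_n f i x * Derive_n g (S j) x).
Proof.
  intros Hf Hg Hi Hj; apply circle_by_parts.
  - apply periodic_Derive_n, Hf.
  - apply periodic_Derive_n, Hg.
  - apply smooth_is_derive with p; auto.
  - apply smooth_is_derive with p; auto.
  - apply smooth_cont with p; auto.
  - apply smooth_cont with p; auto.
Qed.

(** The quadratic form of [ell eps], symmetric and nonnegative by inspection. *)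
Definition dirichlet (eps : R) (f g : R -> R) : R :=
  circle_int (fun x => Derive_n f 1 x * Derive_n g 1 x)
  + eps ^ 2 * circle_int (fun x => Derive_n f 2 x * Derive_n g 2 x).

Lemma circle_ell eps f g : smooth (xorder eps) f -> smooth (xorder eps) g ->
  circle_int (fun x => ell eps f x * g x) = dirichlet eps f g.
Proof.
  intros Hf Hg; unfold ell, dirichlet; assert (H2 := xorder_ge2 eps).
  assert (E2 := circle_shift_derivative _ f g 1 0 Hf Hg H2 ltac:(lia)).
  change (Derive_n g 0) with g in E2.
  assert (Cg : cont1 g) by (apply (smooth_cont _ g 0 Hg); lia).
  assert (Cf2 := smooth_cont _ f 2 Hf H2).
  destruct (xorder_cases eps) as [->|E].
  - rewrite (circle_ext _ (fun x => (-1) * (Derive_n f 2 x * g x))) by (intros; ring).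
    rewrite circle_scal by cont. rewrite E2. ring.
  - rewrite E in *.
    assert (Cf4 := smooth_cont _ f 4 Hf ltac:(lia)).
    rewrite (circle_ext _ (fun x => (-1) * (Derive_n f 2 x * g x)
        + eps ^ 2 * (Derive_n f 4 x * g x))) by (intros; ring).
    rewrite circle_plus, !circle_scal by cont. rewrite E2.
    assert (E4 := circle_shift_derivative _ f g 3 0 Hf Hg ltac:(lia) ltac:(lia)).
    change (Derive_n g 0) with g in E4; rewrite E4.
    rewrite (circle_shift_derivative _ f g 2 1 Hf Hg) by lia. ring.
Qed.

Lemma dirichlet_sym eps f g : dirichlet eps f g = dirichlet eps g f.
Proof.
  unfold dirichlet; f_equal; [|f_equal]; apply circle_ext; intros; ring.
Qed.

Lemma dirichlet_nonneg eps f : smooth (xorder eps) f -> 0 <= dirichlet eps f f.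
Proof.
  intros Hf; unfold dirichlet; assert (H2 := xorder_ge2 eps).
  assert (C1 := smooth_cont _ f 1 Hf ltac:(lia)).
  assert (C2 := smooth_cont _ f 2 Hf ltac:(lia)).
  assert (P1 : 0 <= circle_int (fun x => Derive_n f 1 x * Derive_n f 1 x))
    by (apply circle_nonneg; cont; intros; apply Rle_0_sqr).
  assert (P2 : 0 <= circle_int (fun x => Derive_n f 2 x * Derive_n f 2 x))
    by (apply circle_nonneg; cont; intros; apply Rle_0_sqr).
  assert (P3 := pow2_ge_0 eps). nra.
Qed.

(** The acoustic operator [1 - eps^2 d_xx], with [ell eps n = - d_xx (acoustic eps n)]. *)
Definition acoustic (eps : R) (f : R -> R) (x : R) : R :=
  f x - eps ^ 2 * Derive_n f 2 x.

Lemma circle_acoustic eps f g : smooth (xorder eps) f -> smooth (xorder eps) g ->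
  circle_int (fun x => acoustic eps f x * g x)
  = circle_int (fun x => f x * g x)
    + eps ^ 2 * circle_int (fun x => Derive_n f 1 x * Derive_n g 1 x).
Proof.
  intros Hf Hg; unfold acoustic; assert (H2 := xorder_ge2 eps).
  assert (E2 := circle_shift_derivative _ f g 1 0 Hf Hg H2 ltac:(lia)).
  change (Derive_n g 0) with g in E2.
  assert (Cf : cont1 f) by (apply (smooth_cont _ f 0 Hf); lia).
  assert (Cg : cont1 g) by (apply (smooth_cont _ g 0 Hg); lia).
  assert (Cf2 := smooth_cont _ f 2 Hf H2).
  rewrite (circle_ext _ (fun x => f x * g x - eps ^ 2 * (Derive_n f 2 x * g x)))
    by (intros; ring).
  rewrite circle_minus, circle_scal by cont. rewrite E2. ring.
Qed.

(** For [eps = 0] the derivatives of order three and four need not exist, but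
    they only occur multiplied by [eps ^ 2]. *)
Lemma weighted_is_derive eps f j : smooth (xorder eps) f -> (j < 4)%nat ->
  forall x, is_derive (fun y => eps ^ 2 * Derive_n f j y) x
                      (eps ^ 2 * Derive_n f (S j) x).
Proof.
  intros Hf Hj x; destruct (xorder_cases eps) as [->|E].
  - replace (0 ^ 2 * Derive_n f (S j) x) with 0 by ring.
    apply is_derive_ext with (fun _ => 0);
      [intros y; change (0 = 0 ^ 2 * Derive_n f j y :> R); ring|].
    apply (is_derive_const (V := R_NormedModule)).
  - apply is_derive_scal, (smooth_is_derive (xorder eps)); auto; lia.
Qed.

(** * The system in real form *)

Definition mod2_x (f g : R -> R) (x : R) : R :=
  2 * (f x * Derive_n f 1 x + g x * Derive_n g 1 x).

Definition mod2_xx (f g : R -> R) (x : R) : R :=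
  2 * (Derive_n f 1 x * Derive_n f 1 x + f x * Derive_n f 2 x
       + (Derive_n g 1 x * Derive_n g 1 x + g x * Derive_n g 2 x)).

Lemma is_derive_Rplus (f g : R -> R) x df dg : is_derive f x df -> is_derive g x dg ->
  is_derive (fun y => f y + g y) x (df + dg).
Proof. apply (is_derive_plus (V := R_NormedModule)). Qed.

Lemma is_derive_Rminus (f g : R -> R) x df dg : is_derive f x df -> is_derive g x dg ->
  is_derive (fun y => f y - g y) x (df - dg).
Proof. apply (is_derive_minus (V := R_NormedModule)). Qed.

Lemma is_derive_Rconst c x : is_derive (fun _ : R => c) x 0.
Proof. apply (is_derive_const (V := R_NormedModule)). Qed.

Lemma is_derive_eq (f : R -> R) (x d d' : R) : is_derive f x d -> d = d' -> is_derive f x d'.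
Proof. intros H <-; auto. Qed.

Ltac derive_rules :=
  lazymatch goal with
  | |- is_derive (fun y => @?f y + @?g y) _ _ => apply (is_derive_Rplus f g); derive_rules
  | |- is_derive (fun y => @?f y - @?g y) _ _ => apply (is_derive_Rminus f g); derive_rules
  | |- is_derive (fun y => @?f y * @?g y) _ _ => apply (is_derive_Rmult f g); derive_rules
  | |- is_derive (fun _ => ?c) _ _ => apply (is_derive_Rconst c)
  | |- _ => eassumption
  end.

Lemma is_derive_mod2 p f g x : smooth p f -> smooth p g -> (2 <= p)%nat ->
  is_derive (fun y => f y * f y + g y * g y) x (mod2_x f g x) /\
  is_derive (mod2_x f g) x (mod2_xx f g x).
Proof.
  intros Hf Hg Hp.
  assert (F0 := smooth_is_derive p f 0 Hf ltac:(lia) x).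
  assert (F1 := smooth_is_derive p f 1 Hf ltac:(lia) x).
  assert (G0 := smooth_is_derive p g 0 Hg ltac:(lia) x).
  assert (G1 := smooth_is_derive p g 1 Hg ltac:(lia) x).
  change (Derive_n f 0) with f in F0; change (Derive_n g 0) with g in G0.
  split.
  - eapply is_derive_eq; [derive_rules|unfold mod2_x; ring].
  - unfold mod2_x; eapply is_derive_eq; [derive_rules|unfold mod2_xx; ring].
Qed.

(** The real and imaginary part of u, with n and v = n_t. The functions are
    defined and continuous for all times; the equations hold for positive ones. *)
Record real_solution (eps : R) (a b n v : R -> R -> R) : Prop := {
  rs_smooth_a : forall t, smooth (xorder eps) (a t);
  rs_smooth_b : forall t, smooth (xorder eps) (b t);
  rs_smooth_n : forall t, smooth (xorder eps) (n t);
  rs_cont_a : forall j, (j <= xorder eps)%nat -> cont2 (fun t => Derive_n (a t) j);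
  rs_cont_b : forall j, (j <= xorder eps)%nat -> cont2 (fun t => Derive_n (b t) j);
  rs_cont_n : forall j, (j <= xorder eps)%nat -> cont2 (fun t => Derive_n (n t) j);
  rs_cont_v : cont2 v;
  rs_a : forall t x, 0 < t ->
    is_derive (fun s => a s x) t (ell eps (b t) x + b t x * n t x);
  rs_b : forall t x, 0 < t ->
    is_derive (fun s => b s x) t (- ell eps (a t) x - a t x * n t x);
  rs_n : forall t x, 0 < t -> is_derive (fun s => n s x) t (v t x);
  rs_v : forall t x, 0 < t ->
    is_derive (fun s => v s x) t (- ell eps (n t) x + mod2_xx (a t) (b t) x) }.

Section Families.

Variable eps : R.
Variable f : R -> R -> R.
Hypothesis Hc : forall j, (j <= xorder eps)%nat -> cont2 (fun t => Derive_n (f t) j).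

Lemma cont2_weighted j : (j <= 4)%nat -> cont2 (fun t x => eps ^ 2 * Derive_n (f t) j x).
Proof.
  intros Hj; destruct (xorder_cases eps) as [->|E].
  - apply cont2_ext with (fun _ _ => 0); [intros; ring|cont].
  - apply cont2_mult; cont. apply Hc; lia.
Qed.

Lemma cont2_ell : cont2 (fun t x => ell eps (f t) x).
Proof.
  unfold ell; apply cont2_plus; [apply cont2_opp, Hc, xorder_ge2|apply cont2_weighted; lia].
Qed.

Lemma cont2_acoustic : cont2 (fun t x => acoustic eps (f t) x).
Proof.
  unfold acoustic; apply cont2_minus; [apply (Hc 0); lia|apply cont2_weighted; lia].
Qed.

End Families.

(** ** The potential of the wave equation *)

(** With q the time integral of this source, the wave equation is the
    Hamiltonian system n_t = q_xx, q_t = source, and q_x stands for the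
    antiderivative of n_t in the energy. The constant m does not change q_xx; it
    is chosen to make the coupling in the energy small near the wave. *)
Definition source (eps m : R) (a b n : R -> R -> R) (t x : R) : R :=
  acoustic eps (n t) x + (a t x * a t x + b t x * b t x - m).

Definition potential (eps m : R) (a b n : R -> R -> R) (t x : R) : R :=
  RInt (fun s => source eps m a b n s x) 0 t.

(** A continuous partial derivative in time and a mere partial derivative in space
    already make the function differentiable. *)
Lemma cont2_of_derivatives (w wt wx : R -> R -> R) : cont2 wt ->
  (forall t x, is_derive (fun s => w s x) t (wt t x)) ->
  (forall t x, is_derive (w t) x (wx t x)) -> cont2 w.
Proof.
  intros Ct Dt Dx t x; apply continuity_2d_pt_filterlim.
  apply (filterdiff_continuous (K := R_AbsRing)
           (U := prod_NormedModule R_AbsRing R_NormedModule R_NormedModule)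
           (V := R_NormedModule) (fun z : R * R => w (fst z) (snd z)) (t, x)).
  eexists; apply (is_derive_filterdiff w t x wt (wx t x)); auto.
  - apply filter_forall; intros [s y]; apply Dt.
  - apply continuity_2d_pt_filterlim, Ct.
Qed.

Section Wave.

Variables eps m : R.
Variables a b n v : R -> R -> R.
Hypothesis sol : real_solution eps a b n v.

Let G := source eps m a b n.
Let q := potential eps m a b n.

Let H2 := xorder_ge2 eps.
Let Ca := rs_cont_a _ _ _ _ _ sol.
Let Cb := rs_cont_b _ _ _ _ _ sol.
Let Cn := rs_cont_n _ _ _ _ _ sol.
Let Sa := rs_smooth_a _ _ _ _ _ sol.
Let Sb := rs_smooth_b _ _ _ _ _ sol.
Let Sn := rs_smooth_n _ _ _ _ _ sol.

Lemma cont2_a : cont2 a. Proof. apply (Ca 0); lia. Qed.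
Lemma cont2_b : cont2 b. Proof. apply (Cb 0); lia. Qed.
Lemma cont2_n : cont2 n. Proof. apply (Cn 0); lia. Qed.

Lemma cont2_mod2_x : cont2 (fun t => mod2_x (a t) (b t)).
Proof.
  assert (A0 := cont2_a); assert (B0 := cont2_b).
  assert (A1 := Ca 1 ltac:(lia)); assert (B1 := Cb 1 ltac:(lia)).
  unfold mod2_x; cont.
Qed.

Lemma cont2_mod2_xx : cont2 (fun t => mod2_xx (a t) (b t)).
Proof.
  assert (A0 := cont2_a); assert (B0 := cont2_b).
  assert (A1 := Ca 1 ltac:(lia)); assert (B1 := Cb 1 ltac:(lia)).
  assert (A2 := Ca 2 H2); assert (B2 := Cb 2 H2).
  unfold mod2_xx; cont.
Qed.

(* The first and the second space derivative of the source. *)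
Let G1 t x := Derive_n (n t) 1 x - eps ^ 2 * Derive_n (n t) 3 x + mod2_x (a t) (b t) x.
Let G2 t x := - ell eps (n t) x + mod2_xx (a t) (b t) x.

Lemma cont2_source : cont2 G.
Proof.
  assert (A0 := cont2_a); assert (B0 := cont2_b).
  assert (K := cont2_acoustic eps n Cn).
  unfold G, source; cont.
Qed.

Lemma cont2_G1 : cont2 G1.
Proof.
  apply cont2_plus; [apply cont2_minus|apply cont2_mod2_x].
  - apply Cn; lia.
  - apply (cont2_weighted eps n Cn); lia.
Qed.

Lemma cont2_G2 : cont2 G2.
Proof. apply cont2_plus; [apply cont2_opp, cont2_ell, Cn|apply cont2_mod2_xx]. Qed.

Lemma source_x t x : is_derive (G t) x (G1 t x).
Proof.
  destruct (is_derive_mod2 _ (a t) (b t) x (Sa t) (Sb t) H2) as [D _].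
  assert (D0 := smooth_is_derive _ (n t) 0 (Sn t) ltac:(lia) x).
  assert (D2 := weighted_is_derive eps (n t) 2 (Sn t) ltac:(lia) x).
  change (Derive_n (n t) 0) with (n t) in D0.
  unfold G, source, acoustic; eapply is_derive_eq.
  - apply is_derive_Rplus; [apply is_derive_Rminus; eassumption|].
    apply is_derive_Rminus; [eassumption|apply is_derive_Rconst].
  - unfold G1; ring.
Qed.

Lemma source_xx t x : is_derive (G1 t) x (G2 t x).
Proof.
  destruct (is_derive_mod2 _ (a t) (b t) x (Sa t) (Sb t) H2) as [_ D].
  assert (D1 := smooth_is_derive _ (n t) 1 (Sn t) ltac:(lia) x).
  assert (D3 := weighted_is_derive eps (n t) 3 (Sn t) ltac:(lia) x).
  unfold G1; eapply is_derive_eq.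
  - apply is_derive_Rplus; [apply is_derive_Rminus; eassumption|eassumption].
  - unfold G2, ell; ring.
Qed.

Lemma potential_t t x : is_derive (fun s => q s x) t (G t x).
Proof.
  apply (is_derive_RInt (V := R_NormedModule) (fun s => G s x) _ 0).
  - apply filter_forall; intros s. apply (RInt_correct (V := R_CompleteNormedModule)).
    apply (ex_RInt_continuous (V := R_CompleteNormedModule)); intros z _.
    apply (cont2_col G x cont2_source).
  - apply (cont2_col G x cont2_source).
Qed.

Let q1 t x := RInt (fun s => G1 s x) 0 t.

Lemma potential_x t x : is_derive (q t) x (q1 t x).
Proof.
  apply (is_derive_RInt_row (fun y s => G s y) (fun y s => G1 s y)).
  - apply filter_forall; intros y s; apply source_x.
  - apply cont2_swap, cont2_source.
  - apply cont2_swap, cont2_G1.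
Qed.

Lemma potential_x_x t x : is_derive (q1 t) x (RInt (fun s => G2 s x) 0 t).
Proof.
  apply (is_derive_RInt_row (fun y s => G1 s y) (fun y s => G2 s y)).
  - apply filter_forall; intros y s; apply source_xx.
  - apply cont2_swap, cont2_G1.
  - apply cont2_swap, cont2_G2.
Qed.

Lemma cont2_potential : cont2 q.
Proof.
  apply cont2_of_derivatives with G q1;
    [apply cont2_source|apply potential_t|apply potential_x].
Qed.

Lemma potential_periodic t : periodic (q t).
Proof.
  intros x; apply RInt_ext; intros s _. unfold source, acoustic.
  rewrite (proj1 (Sn s)), (periodic_Derive_n _ 2 (proj1 (Sn s)) x), (proj1 (Sa s)),
    (proj1 (Sb s)); reflexivity.
Qed.

Hypothesis v0 : forall x, v 0 x = 0.

(** The equation n_t = q_xx; it needs the vanishing of n_t at time 0. *)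
Lemma v_integral t x : 0 <= t -> v t x = RInt (fun s => G2 s x) 0 t.
Proof.
  intros Ht. set (h s := v s x - RInt (fun s => G2 s x) 0 s).
  assert (Dint : forall s, is_derive (RInt (fun s => G2 s x) 0) s (G2 s x)).
  { intros s; apply (is_derive_RInt (V := R_NormedModule) (fun s => G2 s x) _ 0).
    - apply filter_forall; intros r. apply (RInt_correct (V := R_CompleteNormedModule)).
      apply (ex_RInt_continuous (V := R_CompleteNormedModule)); intros z _.
      apply (cont2_col G2 x cont2_G2).
    - apply (cont2_col G2 x cont2_G2). }
  assert (E : h t = h 0).
  { apply constant_of_is_derive_zero; auto.
    - apply cont1_minus; [apply (cont2_col v x (rs_cont_v _ _ _ _ _ sol))|].
      eapply cont1_is_derive; apply Dint.
    - intros s Hs; eapply is_derive_eq.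
      + apply is_derive_Rminus; [apply (rs_v _ _ _ _ _ sol); auto|apply Dint].
      + apply Rminus_diag. }
  unfold h in E. rewrite v0, RInt_point in E. unfold zero in E; simpl in E. lra.
Qed.

Lemma circle_v_potential r s : 0 <= r ->
  circle_int (fun x => v r x * q s x) = - circle_int (fun x => q1 r x * q1 s x).
Proof.
  intros Hr; apply circle_by_parts.
  - intros x; apply RInt_ext; intros t _. unfold G1, mod2_x.
    rewrite (periodic_Derive_n _ 1 (proj1 (Sn t)) x), (periodic_Derive_n _ 3 (proj1 (Sn t)) x),
      (periodic_Derive_n _ 1 (proj1 (Sa t)) x), (periodic_Derive_n _ 1 (proj1 (Sb t)) x),
      (proj1 (Sa t)), (proj1 (Sb t)); reflexivity.
  - apply potential_periodic.
  - intros x; rewrite v_integral by auto; apply potential_x_x.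
  - intros x; apply potential_x.
  - apply cont2_row, (rs_cont_v _ _ _ _ _ sol).
  - eapply cont1_is_derive; apply potential_x_x.
Qed.

Lemma circle_v_potential_sym r s : 0 <= r -> 0 <= s ->
  circle_int (fun x => v r x * q s x) = circle_int (fun x => v s x * q r x).
Proof.
  intros Hr Hs; rewrite !circle_v_potential by auto.
  f_equal; apply circle_ext; intros; ring.
Qed.

Lemma circle_v_potential_nonpos t : 0 <= t -> circle_int (fun x => v t x * q t x) <= 0.
Proof.
  intros Ht; rewrite circle_v_potential by auto.
  assert (C1 : cont1 (q1 t)) by (eapply cont1_is_derive; apply potential_x_x).
  assert (P : 0 <= circle_int (fun x => q1 t x * q1 t x))
    by (apply circle_nonneg; cont; intros; apply Rle_0_sqr).
  lra.
Qed.

End Wave.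

(** * Uniqueness around a wave of constant modulus *)

Section Uniqueness.

Variables eps om m : R.
Variables a b n v U V : R -> R -> R.
Hypothesis sol : real_solution eps a b n v.
Hypothesis wave : real_solution eps U V (fun _ _ => 0) (fun _ _ => 0).
Hypothesis eigenU : forall t x, ell eps (U t) x = om * U t x.
Hypothesis eigenV : forall t x, ell eps (V t) x = om * V t x.
Hypothesis modulus : forall t x, U t x * U t x + V t x * V t x = m.
Hypothesis a0 : forall x, a 0 x = U 0 x.
Hypothesis b0 : forall x, b 0 x = V 0 x.
Hypothesis n0 : forall x, n 0 x = 0.
Hypothesis v0 : forall x, v 0 x = 0.

Let c t x := a t x - U t x.
Let d t x := b t x - V t x.
Let lc t x := ell eps (a t) x - ell eps (U t) x.
Let ld t x := ell eps (b t) x - ell eps (V t) x.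
Let ct t x := ell eps (b t) x + b t x * n t x - (ell eps (V t) x + V t x * 0).
Let dt t x := - ell eps (a t) x - a t x * n t x - (- ell eps (U t) x - U t x * 0).
Let K t x := acoustic eps (n t) x.
Let G := source eps m a b n.
Let q := potential eps m a b n.

Let Ca : cont2 a := cont2_a _ _ _ _ _ sol.
Let Cb : cont2 b := cont2_b _ _ _ _ _ sol.
Let Cn : cont2 n := cont2_n _ _ _ _ _ sol.
Let CU : cont2 U := cont2_a _ _ _ _ _ wave.
Let CV : cont2 V := cont2_b _ _ _ _ _ wave.
Let Cv : cont2 v := rs_cont_v _ _ _ _ _ sol.
Let Cla : cont2 (fun t x => ell eps (a t) x) := cont2_ell eps a (rs_cont_a _ _ _ _ _ sol).
Let Clb : cont2 (fun t x => ell eps (b t) x) := cont2_ell eps b (rs_cont_b _ _ _ _ _ sol).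
Let ClU : cont2 (fun t x => ell eps (U t) x) := cont2_ell eps U (rs_cont_a _ _ _ _ _ wave).
Let ClV : cont2 (fun t x => ell eps (V t) x) := cont2_ell eps V (rs_cont_b _ _ _ _ _ wave).
Let Rla t : cont1 (ell eps (a t)) := cont2_row _ t Cla.
Let Rlb t : cont1 (ell eps (b t)) := cont2_row _ t Clb.
Let CK : cont2 K := cont2_acoustic eps n (rs_cont_n _ _ _ _ _ sol).
Let Cq : cont2 q := cont2_potential eps m _ _ _ _ sol.
Let CG : cont2 G := cont2_source eps m _ _ _ _ sol.
Let Cc : cont2 c. Proof. unfold c; cont. Qed.
Let Cd : cont2 d. Proof. unfold d; cont. Qed.
Let Clc : cont2 lc. Proof. unfold lc; cont. Qed.
Let Cld : cont2 ld. Proof. unfold ld; cont. Qed.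
Let Cct : cont2 ct. Proof. unfold ct; cont. Qed.
Let Cdt : cont2 dt. Proof. unfold dt; cont. Qed.

Let Sc t : smooth (xorder eps) (c t).
Proof.
  apply smooth_minus; [apply (rs_smooth_a _ _ _ _ _ sol)|apply (rs_smooth_a _ _ _ _ _ wave)].
Qed.

Let Sd t : smooth (xorder eps) (d t).
Proof.
  apply smooth_minus; [apply (rs_smooth_b _ _ _ _ _ sol)|apply (rs_smooth_b _ _ _ _ _ wave)].
Qed.

Let Elc t x : ell eps (c t) x = lc t x.
Proof.
  apply ell_minus; [apply (rs_smooth_a _ _ _ _ _ sol)|apply (rs_smooth_a _ _ _ _ _ wave)].
Qed.

Let Eld t x : ell eps (d t) x = ld t x.
Proof.
  apply ell_minus; [apply (rs_smooth_b _ _ _ _ _ sol)|apply (rs_smooth_b _ _ _ _ _ wave)].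
Qed.

Let Dc t x : 0 < t -> is_derive (fun s => c s x) t (ct t x).
Proof.
  intros Ht; apply is_derive_Rminus; [apply (rs_a _ _ _ _ _ sol)|apply (rs_a _ _ _ _ _ wave)];
    auto.
Qed.

Let Dd t x : 0 < t -> is_derive (fun s => d s x) t (dt t x).
Proof.
  intros Ht; apply is_derive_Rminus; [apply (rs_b _ _ _ _ _ sol)|apply (rs_b _ _ _ _ _ wave)];
    auto.
Qed.

Let pair_c f r : smooth (xorder eps) f ->
  circle_int (fun x => lc r x * f x) = dirichlet eps (c r) f.
Proof.
  intros Hf; rewrite <- circle_ell by auto; apply circle_ext; intros; rewrite Elc; ring.
Qed.

Let pair_d f r : smooth (xorder eps) f ->
  circle_int (fun x => ld r x * f x) = dirichlet eps (d r) f.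
Proof.
  intros Hf; rewrite <- circle_ell by auto; apply circle_ext; intros; rewrite Eld; ring.
Qed.

Let pair_cd t : circle_int (fun x => c t x * ld t x - d t x * lc t x) = 0.
Proof.
  rewrite circle_minus by cont.
  rewrite (circle_ext _ (fun x => ld t x * c t x)) by (intros; ring).
  rewrite (circle_ext (fun x => d t x * _) (fun x => lc t x * d t x)) by (intros; ring).
  rewrite pair_c, pair_d, dirichlet_sym by auto; ring.
Qed.

(** The squared distance to the wave in mass. *)
Let W t := circle_int (fun x => c t x * c t x + d t x * d t x).
Let dW t := circle_int (fun x => 2 * (n t x * (V t x * c t x - U t x * d t x))).

Let W_derive t : 0 < t -> is_derive W t (dW t).
Proof.
  intros Ht; eapply is_derive_eq.
  - apply (is_derive_circle (fun t x => c t x * c t x + d t x * d t x)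
             (fun t x => ct t x * c t x + c t x * ct t x + (dt t x * d t x + d t x * dt t x)));
      cont.
    intros s x Hs; assert (E1 := Dc s x Hs); assert (E2 := Dd s x Hs); derive_rules.
  - unfold dW.
    rewrite (circle_ext _ (fun x => 2 * (c t x * ld t x - d t x * lc t x)
       + 2 * (n t x * (V t x * c t x - U t x * d t x))))
      by (intros; unfold ct, dt, lc, ld, c, d; ring).
    rewrite circle_plus, circle_scal, pair_cd by cont; ring.
Qed.

(** Energy minus [om] times mass, relative to its value at the wave. The wave
    is a critical point of this combination, so there is no linear term in
    the perturbation [c + i d]. *)
Let Q t := circle_int (fun x => lc t x * c t x) + circle_int (fun x => ld t x * d t x)
  + / 2 * circle_int (fun x => K t x * n t x) - / 2 * circle_int (fun x => v t x * q t x)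
  + circle_int (fun x => n t x * (a t x * a t x + b t x * b t x - m)
                         - om * (c t x * c t x + d t x * d t x)).

Let Q_derive t : 0 < t -> is_derive Q t 0.
Proof.
  intros Ht.
  assert (D1 := is_derive_symmetric_pairing lc c ct t Ht Clc Cc Cct
    (fun s x => Dc s x)).
  assert (D2 := is_derive_symmetric_pairing ld d dt t Ht Cld Cd Cdt
    (fun s x => Dd s x)).
  assert (D3 := is_derive_symmetric_pairing K n v t Ht CK Cn Cv (rs_n _ _ _ _ _ sol)).
  assert (D4 := is_derive_symmetric_pairing v q G t Ht Cv Cq CG
    (fun s x _ => potential_t eps m _ _ _ _ sol s x)).
  assert (Sn := rs_smooth_n _ _ _ _ _ sol).
  specialize (D1 ltac:(intros; rewrite !pair_c, dirichlet_sym; auto)).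
  specialize (D2 ltac:(intros; rewrite !pair_d, dirichlet_sym; auto)).
  specialize (D3 ltac:(intros; unfold K; rewrite !circle_acoustic by auto;
    f_equal; [|f_equal]; apply circle_ext; intros; ring)).
  specialize (D4 ltac:(intros; apply circle_v_potential_sym; auto; lra)).
  assert (D5 : is_derive (fun s => circle_int
      (fun x => n s x * (a s x * a s x + b s x * b s x - m)
                - om * (c s x * c s x + d s x * d s x))) t (circle_int (fun x =>
      v t x * (a t x * a t x + b t x * b t x - m)
      + n t x * (2 * (a t x * (ell eps (b t) x + b t x * n t x)
                      + b t x * (- ell eps (a t) x - a t x * n t x)))
      - om * (2 * (c t x * ct t x + d t x * dt t x))))).
  { apply (is_derive_circle
      (fun s x => n s x * (a s x * a s x + b s x * b s x - m)
                - om * (c s x * c s x + d s x * d s x))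
      (fun t x => v t x * (a t x * a t x + b t x * b t x - m)
      + n t x * (2 * (a t x * (ell eps (b t) x + b t x * n t x)
                      + b t x * (- ell eps (a t) x - a t x * n t x)))
      - om * (2 * (c t x * ct t x + d t x * dt t x)))); cont.
    intros s x Hs.
    assert (E1 := Dc s x Hs); assert (E2 := Dd s x Hs).
    assert (E3 := rs_a _ _ _ _ _ sol s x Hs); assert (E4 := rs_b _ _ _ _ _ sol s x Hs).
    assert (E5 := rs_n _ _ _ _ _ sol s x Hs).
    eapply is_derive_eq; [derive_rules|ring]. }
  eapply is_derive_eq.
  { unfold Q; derive_rules. }
  rewrite !Rmult_0_l, !Rplus_0_l.
  rewrite <- !circle_scal, <- circle_plus, <- circle_plus, <- circle_minus, <- circle_plus by cont.
  rewrite (circle_ext _ (fun x => (-2 * om) * (c t x * ld t x - d t x * lc t x))).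
  - rewrite circle_scal, pair_cd by cont; ring.
  - intros x; unfold G, source, K, lc, ld, c, d, ct, dt; rewrite !eigenU, !eigenV; field.
Qed.

Let Q_zero t : 0 <= t -> Q t = 0.
Proof.
  intros Ht.
  assert (CQ : cont1 Q).
  { unfold Q; repeat first [apply cont1_minus|apply cont1_plus];
      try (apply cont1_mult; [cont|]).
    - apply (cont1_circle (fun t x => lc t x * c t x)); cont.
    - apply (cont1_circle (fun t x => ld t x * d t x)); cont.
    - apply (cont1_circle (fun t x => K t x * n t x)); cont.
    - apply (cont1_circle (fun t x => v t x * q t x)); cont.
    - apply (cont1_circle (fun t x => n t x * (a t x * a t x + b t x * b t x - m)
                         - om * (c t x * c t x + d t x * d t x))); cont. }
  rewrite (constant_of_is_derive_zero Q) by auto.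
  assert (Z0 : forall f, (forall x, f x = 0) -> circle_int f = 0).
  { intros f Hf; rewrite (circle_ext _ (fun _ => 0) Hf); apply circle_zero. }
  unfold Q; rewrite !Z0; try ring; intros x; unfold c, d; rewrite ?a0, ?b0, ?n0, ?v0; ring.
Qed.

Let N t := circle_int (fun x => n t x * n t x).

Let W_nonneg t : 0 <= W t.
Proof.
  apply circle_nonneg; cont; intros x.
  assert (P1 := Rle_0_sqr (c t x)); assert (P2 := Rle_0_sqr (d t x)); unfold Rsqr in *; lra.
Qed.

(** All quadratic terms of the conserved [Q] are nonnegative except [- om W], and
    the coupling is absorbed by the square of n. *)
Let n_bound t B : 0 <= t -> 0 <= B ->
  (forall x, 0 <= x <= 2 * PI -> Rabs (a t x + U t x) <= B /\ Rabs (b t x + V t x) <= B) ->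
  N t <= 4 * (2 * B ^ 2 + om) * W t.
Proof.
  intros Ht HB Hab.
  assert (E := Q_zero t Ht); unfold Q in E.
  rewrite pair_c, pair_d in E by auto.
  assert (P1 := dirichlet_nonneg eps (c t) (Sc t)).
  assert (P2 := dirichlet_nonneg eps (d t) (Sd t)).
  assert (P4 := circle_v_potential_nonpos eps m _ _ _ _ sol v0 t Ht); fold q in P4.
  assert (Sn := rs_smooth_n _ _ _ _ _ sol t).
  assert (P3 : N t <= circle_int (fun x => K t x * n t x)).
  { unfold K; rewrite circle_acoustic by auto.
    assert (P := pow2_ge_0 eps).
    assert (C1 := smooth_cont _ (n t) 1 Sn ltac:(assert (H := xorder_ge2 eps); lia)).
    assert (0 <= circle_int (fun x => Derive_n (n t) 1 x * Derive_n (n t) 1 x))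
      by (apply circle_nonneg; cont; intros; apply Rle_0_sqr).
    unfold N; nra. }
  assert (P5 : - / 4 * N t - (2 * B ^ 2 + om) * W t
     <= circle_int (fun x => n t x * (a t x * a t x + b t x * b t x - m)
                         - om * (c t x * c t x + d t x * d t x))).
  { unfold N, W; rewrite <- !circle_scal, <- circle_minus by cont.
    apply circle_le; cont. intros x Hx.
    destruct (Hab x ltac:(lra)) as [Ba Bb].
    apply Rabs_le_between in Ba; apply Rabs_le_between in Bb.
    rewrite <- (modulus t x).
    replace (a t x * a t x + b t x * b t x - (U t x * U t x + V t x * V t x))
      with (c t x * (a t x + U t x) + d t x * (b t x + V t x)) by (unfold c, d; ring).
    assert (F1 : 0 <= (n t x + 4 * (c t x * (a t x + U t x))) ^ 2) by apply pow2_ge_0.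
    assert (F2 : 0 <= (n t x + 4 * (d t x * (b t x + V t x))) ^ 2) by apply pow2_ge_0.
    assert (G1 : (a t x + U t x) ^ 2 <= B ^ 2) by nra.
    assert (G2 : (b t x + V t x) ^ 2 <= B ^ 2) by nra.
    assert (S1 := pow2_ge_0 (c t x)); assert (S2 := pow2_ge_0 (d t x)).
    assert (M1 := Rmult_le_compat_l _ _ _ S1 G1).
    assert (M2 := Rmult_le_compat_l _ _ _ S2 G2).
    nra. }
  lra.
Qed.

Let dW_bound t : dW t <= N t + m * W t.
Proof.
  unfold dW, N, W; rewrite <- circle_scal, <- circle_plus by cont.
  apply circle_le; cont; intros x _; rewrite <- (modulus t x).
  assert (F1 := pow2_ge_0 (n t x - (V t x * c t x - U t x * d t x))).
  assert (F2 := pow2_ge_0 (V t x * d t x + U t x * c t x)).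
  lra.
Qed.

Let W_zero T : 0 <= T -> W T = 0.
Proof.
  intros HT; assert (Hp := two_pi_pos).
  destruct (cont2_bounded (fun t x => a t x + U t x) T (2 * PI)) as [B1 [HB1 F1]];
    [cont|auto|lra|].
  destruct (cont2_bounded (fun t x => b t x + V t x) T (2 * PI)) as [B2 [HB2 F2]];
    [cont|auto|lra|].
  apply (gronwall_zero W dW (4 * (2 * (B1 + B2) ^ 2 + om) + m) T); auto.
  - apply (cont1_circle (fun t x => c t x * c t x + d t x * d t x)); cont.
  - unfold W; rewrite (circle_ext _ (fun _ => 0)); [apply circle_zero|].
    intros x; unfold c, d; rewrite a0, b0; ring.
  - intros t Ht. assert (F := dW_bound t).
    assert (H : N t <= 4 * (2 * (B1 + B2) ^ 2 + om) * W t).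
    { apply n_bound; try lra. intros x Hx; split.
      - apply Rle_trans with B1; [apply F1; auto|lra].
      - apply Rle_trans with B2; [apply F2; auto|lra]. }
    lra.
Qed.

Lemma real_solution_unique t x : 0 <= t -> 0 <= x <= 2 * PI ->
  a t x = U t x /\ b t x = V t x /\ n t x = 0.
Proof.
  intros Ht Hx; assert (Hp := two_pi_pos).
  assert (HW := W_zero t Ht).
  destruct (cont2_bounded (fun t x => a t x + U t x) t (2 * PI)) as [B1 [HB1 F1]];
    [cont|auto|lra|].
  destruct (cont2_bounded (fun t x => b t x + V t x) t (2 * PI)) as [B2 [HB2 F2]];
    [cont|auto|lra|].
  assert (HN : N t <= 0).
  { rewrite <- (Rmult_0_r (4 * (2 * (B1 + B2) ^ 2 + om))), <- HW.
    apply n_bound; try lra. intros y Hy; split.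
    - apply Rle_trans with B1; [apply F1; auto|]; lra.
    - apply Rle_trans with B2; [apply F2; auto|]; lra. }
  assert (E1 : c t x * c t x + d t x * d t x = 0).
  { apply (circle_zero_inv (fun x => c t x * c t x + d t x * d t x)); auto.
    - cont.
    - intros y; assert (P1 := Rle_0_sqr (c t y)); assert (P2 := Rle_0_sqr (d t y));
        unfold Rsqr in *; lra.
    - fold (W t); lra. }
  assert (E2 : n t x * n t x = 0).
  { apply (circle_zero_inv (fun x => n t x * n t x)); auto.
    - cont.
    - intros y; apply Rle_0_sqr. }
  assert (c t x = 0) by nra. assert (d t x = 0) by nra. assert (n t x = 0) by nra.
  unfold c, d in *; lra.
Qed.

End Uniqueness.

(** * From classical solutions to real ones *)

Lemma periodic_nat {T : Type} (f : R -> T) k x : periodic f -> f (x + INR k * (2 * PI)) = f x.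
Proof.
  intros Hf; induction k as [|k IH].
  - f_equal; simpl; ring.
  - rewrite S_INR.
    replace (x + (INR k + 1) * (2 * PI)) with (x + INR k * (2 * PI) + 2 * PI) by ring.
    rewrite Hf; apply IH.
Qed.

Lemma periodic_Z {T : Type} (f : R -> T) k x : periodic f -> f (x + IZR k * (2 * PI)) = f x.
Proof.
  intros Hf; destruct (Z_le_gt_dec 0 k) as [Hk|Hk].
  - rewrite <- (periodic_nat f (Z.to_nat k) x Hf).
    rewrite INR_IZR_INZ, Z2Nat.id by auto; reflexivity.
  - rewrite <- (periodic_nat f (Z.to_nat (- k)) (x + _) Hf).
    rewrite INR_IZR_INZ, Z2Nat.id, opp_IZR by lia; f_equal; ring.
Qed.

Lemma periodic_representative x : exists y, 0 <= y <= 2 * PI /\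
  forall (T : Type) (f : R -> T), periodic f -> f x = f y.
Proof.
  assert (Hp := two_pi_pos).
  destruct (base_Int_part (x / (2 * PI))) as [H1 H2].
  set (k := Int_part (x / (2 * PI))) in *.
  assert (E : x = x / (2 * PI) * (2 * PI)) by (field; lra).
  exists (x - IZR k * (2 * PI)); split.
  - assert (F1 := Rmult_le_compat_r (2 * PI) _ _ ltac:(lra) H1).
    assert (F2 : (x / (2 * PI) - IZR k) * (2 * PI) <= 1 * (2 * PI))
      by (apply Rmult_le_compat_r; lra).
    lra.
  - intros T f Hf; rewrite <- (periodic_Z f k (x - _) Hf); f_equal; ring.
Qed.

Lemma within_proper t : 0 <= t -> ProperFilter (within (fun tau => 0 <= tau) (locally t)).
Proof.
  intros Ht; constructor; [|apply within_filter, locally_filter].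
  intros P [d Hd]. exists t; apply Hd; auto. apply ball_center.
Qed.

Lemma is_derive_is_tderive {V : NormedModule R_AbsRing} (f : R -> V) t l : 0 <= t ->
  is_derive f t l -> is_tderive f t l.
Proof.
  intros Ht Hf.
  apply (filterdiff_locally (FF := within_proper t Ht) f t); auto.
  intros P HP; apply filter_le_within, HP.
Qed.

Lemma is_tderive_is_derive {V : NormedModule R_AbsRing} (f : R -> V) t l : 0 < t ->
  is_tderive f t l -> is_derive f t l.
Proof.
  intros Ht [Hl Hf]; split; auto.
  intros x Hx eps.
  assert (Hw : is_filter_lim (within (fun tau => 0 <= tau) (locally t)) x).
  { intros P HP; apply filter_le_within, Hx, HP. }
  specialize (Hf x Hw eps); unfold within in Hf.
  apply filter_imp with (2 := filter_and _ _ Hf (locally_pos t Ht)).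
  intros s [H1 H2]; apply H1; lra.
Qed.

Lemma is_derive_C_components (f : R -> C) t (l : C) :
  is_derive (V := C_R_NormedModule) f t l ->
  is_derive (fun s => Re (f s)) t (Re l) /\ is_derive (fun s => Im (f s)) t (Im l).
Proof.
  intros Hf; split.
  - apply (filterdiff_comp' (K := R_AbsRing) (V := C_R_NormedModule) (W := R_NormedModule)
      f (fun z : C => fst z) t (fun h => scal h l) (fun z : C => fst z) Hf).
    apply (filterdiff_linear (K := R_AbsRing) (U := C_R_NormedModule) (V := R_NormedModule)).
    apply (is_linear_fst (K := R_AbsRing) (U := R_NormedModule) (V := R_NormedModule)).
  - apply (filterdiff_comp' (K := R_AbsRing) (V := C_R_NormedModule) (W := R_NormedModule)
      f (fun z : C => snd z) t (fun h => scal h l) (fun z : C => snd z) Hf).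
    apply (filterdiff_linear (K := R_AbsRing) (U := C_R_NormedModule) (V := R_NormedModule)).
    apply (is_linear_snd (K := R_AbsRing) (U := R_NormedModule) (V := R_NormedModule)).
Qed.

Lemma is_derive_C_pair (f g : R -> R) t df dg : is_derive f t df -> is_derive g t dg ->
  is_derive (V := C_R_NormedModule) (fun s => (f s, g s) : C) t ((df, dg) : C).
Proof.
  intros Hf Hg.
  assert (E : forall r s : R, plus (G := C_R_NormedModule)
     (scal r ((1, 0) : C_R_NormedModule)) (scal s ((0, 1) : C_R_NormedModule)) = (r, s)).
  { intros r s; apply injective_projections; simpl;
      unfold plus, scal; simpl; unfold mult; simpl; ring. }
  rewrite <- E.
  apply (is_derive_ext (V := C_R_NormedModule) (fun u => plus (G := C_R_NormedModule)
    (scal (f u) ((1, 0) : C_R_NormedModule)) (scal (g u) ((0, 1) : C_R_NormedModule)))).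
  - intros u; apply E.
  - apply (is_derive_plus (V := C_R_NormedModule));
      apply (is_derive_scal_l (V := C_R_NormedModule)); auto.
Qed.

(** Freezing time before 0 extends a function continuously to the whole plane. *)
Definition frozen {T : Type} (f : R -> R -> T) (t : R) : R -> T := f (Rmax 0 t).

Lemma frozen_pos {T : Type} (f : R -> R -> T) t : 0 <= t -> frozen f t = f t.
Proof. intros Ht; unfold frozen; rewrite Rmax_right; auto. Qed.

Lemma cont2_frozen f : cont_tx f -> cont2 (frozen f).
Proof.
  intros Hf t x; apply continuity_2d_pt_filterlim.
  intros P HP; simpl in HP.
  destruct (Hf (Rmax 0 t) x (Rmax_l 0 t) P HP) as [e He].
  exists e; intros [s y] [Hs Hy]; simpl in Hs, Hy.
  apply (He (Rmax 0 s, y)); [|apply Rmax_l].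
  split; [simpl|exact Hy].
  change (Rabs (s - t) < e) in Hs; change (Rabs (Rmax 0 s - Rmax 0 t) < e).
  apply Rle_lt_trans with (2 := Hs).
  unfold Rmax; destruct (Rle_dec 0 s), (Rle_dec 0 t);
    unfold Rabs; repeat destruct Rcase_abs; lra.
Qed.

Lemma is_derive_frozen (f : R -> R -> R) t x d : 0 < t ->
  is_derive (fun s => f s x) t d -> is_derive (fun s => frozen f s x) t d.
Proof.
  intros Ht; apply is_derive_ext_loc.
  apply filter_imp with (2 := locally_pos t Ht); intros s Hs; rewrite frozen_pos; auto; lra.
Qed.

Lemma smooth_frozen p f : (forall t, 0 <= t -> periodic (f t)) -> C_x p f ->
  (forall t, smooth p (frozen f t)) /\
  (forall j, (j <= p)%nat -> cont2 (fun t => Derive_n (frozen f t) j)).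
Proof.
  intros Hper Hf.
  assert (Hc : forall j, (j <= p)%nat -> cont2 (fun t => Derive_n (frozen f t) j)).
  { intros j Hj; apply (cont2_frozen (fun t => Derive_n (f t) j)), Hf, Hj. }
  split; auto; intros t; split; [apply Hper, Rmax_l|].
  intros j x Hj; split; [apply (Hf j Hj), Rmax_l|].
  apply (cont2_row _ t (Hc j Hj)).
Qed.

Lemma Derive_n_mod2 p f g x : smooth p f -> smooth p g -> (2 <= p)%nat ->
  Derive_n (fun y => f y * f y + g y * g y) 2 x = mod2_xx f g x.
Proof.
  intros Hf Hg Hp.
  change (Derive (Derive (fun y => f y * f y + g y * g y)) x = mod2_xx f g x).
  rewrite (Derive_ext _ (mod2_x f g)).
  - apply is_derive_unique, (is_derive_mod2 p); auto.
  - intros y; apply is_derive_unique, (is_derive_mod2 p); auto.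
Qed.

Definition re_part (z : trajectory) : R -> R -> R := frozen (fun t x => Re (tu z t x)).
Definition im_part (z : trajectory) : R -> R -> R := frozen (fun t x => Im (tu z t x)).

Lemma classical_solution_real eps u0 n0 n1 z : classical_solution eps u0 n0 n1 z ->
  real_solution eps (re_part z) (im_part z) (frozen (tn z)) (frozen (tv z)).
Proof.
  intros (Hper & HCa & HCb & HCn & HCv & Hn & (ut & vt & _ & _ & Heq) & _).
  destruct (smooth_frozen _ _ (fun t Ht x => f_equal Re (proj1 (Hper t Ht) x)) HCa) as [Sa Ca].
  destruct (smooth_frozen _ _ (fun t Ht x => f_equal Im (proj1 (Hper t Ht) x)) HCb) as [Sb Cb].
  destruct (smooth_frozen _ _ (fun t Ht => proj1 (proj2 (Hper t Ht))) HCn) as [Sn Cn].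
  fold (re_part z) in Sa, Ca; fold (im_part z) in Sb, Cb.
  assert (Hu : forall t x, 0 < t ->
    Im (ut t x) = - ell eps (re_part z t) x - re_part z t x * frozen (tn z) t x /\
    Re (ut t x) = ell eps (im_part z t) x + im_part z t x * frozen (tn z) t x).
  { intros t x Ht; destruct (Heq t x (Rlt_le _ _ Ht)) as (_ & _ & E & _).
    unfold re_part, im_part; rewrite !frozen_pos by lra; unfold ell.
    assert (E1 := f_equal Re E); assert (E2 := f_equal Im E); simpl in E1, E2.
    unfold Re, Im in *; simpl in *. split; lra. }
  split; auto.
  - apply cont2_frozen, HCv.
  - intros t x Ht; destruct (Heq t x (Rlt_le _ _ Ht)) as (D & _).
    apply is_derive_frozen; auto.
    rewrite <- (proj2 (Hu t x Ht)).
    apply (is_derive_C_components (fun s => tu z s x)), is_tderive_is_derive; auto.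
  - intros t x Ht; destruct (Heq t x (Rlt_le _ _ Ht)) as (D & _).
    apply is_derive_frozen; auto.
    rewrite <- (proj1 (Hu t x Ht)).
    apply (is_derive_C_components (fun s => tu z s x)), is_tderive_is_derive; auto.
  - intros t x Ht; apply is_derive_frozen; auto.
    rewrite frozen_pos by lra. apply is_tderive_is_derive; auto. apply Hn; lra.
  - intros t x Ht; destruct (Heq t x (Rlt_le _ _ Ht)) as (_ & D & _ & E).
    apply is_derive_frozen; auto.
    replace (- ell eps (frozen (tn z) t) x + mod2_xx (re_part z t) (im_part z t) x)
      with (vt t x); [apply is_tderive_is_derive; auto|].
    rewrite <- (Derive_n_mod2 (xorder eps)) by auto using xorder_ge2.
    rewrite (Derive_n_ext _ (fun y => Cmod (tu z t y) ^ 2)).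
    + rewrite frozen_pos by lra; unfold ell; lra.
    + intros y; unfold re_part, im_part; rewrite !frozen_pos by lra.
      rewrite Cmod2_alt; ring.
Qed.

(** * The plane wave *)

Lemma cosine_derivatives A k th j :
  (forall x, ex_derive_n (fun y => A * cos (k * y + th)) j x) /\
  (forall x, Derive_n (fun y => A * cos (k * y + th)) j x
             = A * k ^ j * cos (k * x + (th + INR j * (PI / 2)))).
Proof.
  induction j as [|j [IH1 IH2]].
  - split; [intros x; exact I|intros x; simpl].
    rewrite Rmult_0_l, Rplus_0_r; ring.
  - assert (D : forall x, is_derive (fun y => A * k ^ j * cos (k * y + (th + INR j * (PI / 2)))) x
                (A * k ^ S j * cos (k * x + (th + INR (S j) * (PI / 2))))).
    { intros x; auto_derive; auto. rewrite S_INR.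
      replace (k * x + (th + (INR j + 1) * (PI / 2)))
        with (PI / 2 + (k * x + (th + INR j * (PI / 2)))) by ring.
      rewrite <- tech_pow_Rmult.
      replace (cos (PI / 2 + _)) with (- sin (k * x + (th + INR j * (PI / 2))))
        by (rewrite sin_cos; ring). ring. }
    split; intros x.
    + apply ex_derive_ext with (fun y => A * k ^ j * cos (k * y + (th + INR j * (PI / 2)))).
      * intros y; symmetry; apply IH2.
      * eexists; apply D.
    + simpl Derive_n.
      rewrite (Derive_ext _ (fun y => A * k ^ j * cos (k * y + (th + INR j * (PI / 2))))) by auto.
      apply is_derive_unique, D.
Qed.

Definition dispersion (eps : R) (N : Z) : R := IZR N ^ 2 + eps ^ 2 * IZR N ^ 4.

Lemma sin_shift y : cos (y - PI / 2) = sin y.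
Proof. rewrite <- cos_neg, <- cos_shift; f_equal; ring. Qed.

Lemma plane_u_re s eps N t x : Re (plane_u s eps N t x)
  = Rpower (jb N) (- s) * cos (IZR N * x + - (t * dispersion eps N)).
Proof.
  unfold plane_u, cis, dispersion, Re; simpl fst.
  rewrite Rmult_0_l, Rminus_0_r; f_equal; f_equal; ring.
Qed.

Lemma plane_u_im s eps N t x : Im (plane_u s eps N t x)
  = Rpower (jb N) (- s) * cos (IZR N * x + (- (t * dispersion eps N) - PI / 2)).
Proof.
  unfold plane_u, cis, dispersion, Im; simpl snd.
  rewrite Rmult_0_l, Rplus_0_r, <- sin_shift; f_equal; f_equal; ring.
Qed.

Lemma cont_tx_of_cont2 f : cont2 f -> cont_tx f.
Proof.
  intros Hf t x _; apply (filterlim_filter_le_1 (F := locally (t, x)));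
    [apply filter_le_within|apply continuity_2d_pt_filterlim, Hf].
Qed.

(** The real and imaginary part of the wave, and 0, are all of this form. *)
Lemma C_x_cosine (f : R -> R -> R) A k (th : R -> R) p : cont1 th ->
  (forall t x, f t x = A * cos (k * x + th t)) -> C_x p f.
Proof.
  intros Hth E j _; split.
  - intros t x _; apply (ex_derive_n_ext (fun y => A * cos (k * y + th t))).
    + intros y; symmetry; apply E.
    + apply cosine_derivatives.
  - apply cont_tx_of_cont2.
    apply cont2_ext with (fun t x => A * k ^ j * cos (k * x + (th t + INR j * (PI / 2)))).
    + intros t x; rewrite (Derive_n_ext _ _ j x (E t)); symmetry; apply cosine_derivatives.
    + apply cont2_mult; cont.
      apply (cont2_comp cos).
      * intros y; apply continuity_pt_filterlim, continuity_cos.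
      * assert (C1 := cont2_time th Hth).
        assert (C2 : cont2 (fun _ x => x)) by (intros t x; apply continuity_2d_pt_id2).
        cont.
Qed.

Lemma cosine_derivative_even (f : R -> R) A k th : (forall x, f x = A * cos (k * x + th)) ->
  forall x, Derive_n f 2 x = - k ^ 2 * f x /\ Derive_n f 4 x = k ^ 4 * f x.
Proof.
  intros E x; rewrite !(Derive_n_ext _ _ _ _ E), !(proj2 (cosine_derivatives A k th _)), E.
  simpl INR; split.
  - replace (k * x + (th + (1 + 1) * (PI / 2))) with (k * x + th + PI) by field.
    rewrite neg_cos; ring.
  - replace (k * x + (th + (1 + 1 + 1 + 1) * (PI / 2))) with (k * x + th + 2 * PI) by field.
    rewrite (cos_plus _ (2 * PI)), cos_2PI, sin_2PI; ring.
Qed.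

Lemma cis_periodic : periodic cis.
Proof.
  intros x; unfold cis; rewrite cos_plus, sin_plus, cos_2PI, sin_2PI; f_equal; ring.
Qed.

Lemma cis_mode_periodic k th : periodic (fun x => cis (th + IZR k * x)).
Proof.
  intros x; rewrite <- (periodic_Z cis k (th + IZR k * x) cis_periodic); f_equal; ring.
Qed.

Lemma cis_plus y z : cis (y + z) = (cis y * cis z)%C.
Proof. unfold cis, Cmult; simpl; rewrite cos_plus, sin_plus; f_equal; ring. Qed.

Lemma Cmod_cis y : Cmod (cis y) = 1.
Proof.
  unfold Cmod, cis; simpl fst; simpl snd. rewrite <- sqrt_1; f_equal.
  assert (E := sin2_cos2 y); unfold Rsqr in E; lra.
Qed.

Lemma Rpower_pos x y : 0 < Rpower x y.
Proof. apply exp_pos. Qed.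

Lemma plane_wave_modulus s eps N t x : Cmod (plane_u s eps N t x) = Rpower (jb N) (- s).
Proof.
  unfold plane_u; rewrite Cmod_mult, Cmod_cis, Cmod_R, Rmult_1_r.
  apply Rabs_pos_eq; left; apply Rpower_pos.
Qed.

Lemma cont1_linear k th : cont1 (fun t => - (t * k) + th).
Proof.
  intros t; apply (ex_derive_continuous (V := R_NormedModule)); auto_derive; auto.
Qed.

Lemma plane_wave_classical s eps N :
  classical_solution eps (plane_u0 s N) (fun _ => 0) (fun _ => 0) (plane_wave s eps N).
Proof.
  set (om := dispersion eps N).
  assert (Cth : cont1 (fun t => - (t * om))).
  { apply cont1_ext with (fun t => - (t * om) + 0); [intros; ring|apply cont1_linear]. }
  assert (Ca := fun p => C_x_cosine (fun t x => Re (plane_u s eps N t x)) _ _ _ p Cth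
                  (plane_u_re s eps N)).
  assert (Cb := fun p => C_x_cosine (fun t x => Im (plane_u s eps N t x)) _ _ _ p
                  (cont1_linear om (- (PI / 2))) (plane_u_im s eps N)).
  assert (Cz : forall p, C_x p (fun _ _ => 0)).
  { intros p; apply (C_x_cosine _ 0 0 _ p Cth); intros; ring. }
  assert (Cz0 : cont_tx (fun _ _ : R => 0)) by (apply cont_tx_of_cont2; cont).
  assert (D0 : forall t, 0 <= t -> is_tderive (fun _ : R => 0) t 0).
  { intros t Ht; apply is_derive_is_tderive; auto; apply is_derive_Rconst. }
  unfold classical_solution; simpl tu; simpl tn; simpl tv.
  split; [|split; [apply Ca|split; [apply Cb|split; [apply Cz|split; [exact Cz0|
    split; [intros; apply D0; auto|split]]]]]].
  - intros t _; split; [|split; intros x; reflexivity].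
    intros x; unfold plane_u.
    rewrite (cis_mode_periodic N (- t * (IZR N ^ 2 + eps ^ 2 * IZR N ^ 4)) x); reflexivity.
  - (* Multiplication of the wave by [- i om]. *)
    exists (fun t x => (om * Im (plane_u s eps N t x), - om * Re (plane_u s eps N t x))).
    exists (fun _ _ => 0).
    split; [|split; [exact Cz0|]].
    + intros t x Ht; apply filterlim_locally; intros e.
      assert (Fa := proj1 (filterlim_locally _ _) (proj2 (Ca 0%nat 0%nat (le_n 0)) t x Ht)).
      assert (Fb := proj1 (filterlim_locally _ _) (proj2 (Cb 0%nat 0%nat (le_n 0)) t x Ht)).
      simpl in Fa, Fb.
      assert (He : 0 < e / (Rabs om + 1)).
      { apply Rdiv_lt_0_compat; [apply cond_pos|]. assert (P := Rabs_pos om); lra. }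
      apply filter_imp with (2 := filter_and _ _ (Fa (mkposreal _ He)) (Fb (mkposreal _ He))).
      assert (Hs : forall y z w, Rabs w = Rabs om ->
        ball (M := R_UniformSpace) y (e / (Rabs om + 1)) z ->
        ball (M := R_UniformSpace) (w * y) e (w * z)).
      { intros y z w Hw Hb; change (Rabs (z - y) < e / (Rabs om + 1)) in Hb.
        change (Rabs (w * z - w * y) < e).
        replace (w * z - w * y) with (w * (z - y)) by ring; rewrite Rabs_mult, Hw.
        assert (P := Rabs_pos om); assert (P' := Rabs_pos (z - y)).
        apply Rcomplements.Rlt_div_r in Hb; lra. }
      intros p [Ha Hb]; split; apply Hs; auto using Rabs_Ropp.
    + intros t x Ht; split; [|split; [apply D0; auto|split]].
      * apply is_derive_is_tderive; auto.
        apply (is_derive_ext (V := C_R_NormedModule)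
          (fun tau => (Re (plane_u s eps N tau x), Im (plane_u s eps N tau x)) : C));
          [intros tau; symmetry; apply surjective_pairing|].
        rewrite plane_u_re, plane_u_im. fold om.
        apply is_derive_C_pair.
        -- apply (is_derive_ext (fun tau => Rpower (jb N) (- s) * cos (IZR N * x + - (tau * om)))).
           ++ intros tau; symmetry; apply plane_u_re.
           ++ auto_derive; auto.
              replace (IZR N * x + (- (t * om) - PI / 2)) with (IZR N * x + - (t * om) - PI / 2)
                by ring.
              rewrite sin_shift; ring.
        -- apply (is_derive_ext (fun tau => Rpower (jb N) (- s) * sin (IZR N * x + - (tau * om)))).
           ++ intros tau; rewrite plane_u_im, <- sin_shift; fold om.
              change (Rpower (jb N) (- s) * cos (IZR N * x + - (tau * om) - PI / 2)
                = Rpower (jb N) (- s) * cos (IZR N * x + (- (tau * om) - PI / 2)) :> R).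
              f_equal; f_equal; ring.
           ++ auto_derive; auto. ring.
      * destruct (cosine_derivative_even _ _ _ _ (plane_u_re s eps N t) x) as [A2 A4].
        destruct (cosine_derivative_even _ _ _ _ (plane_u_im s eps N t) x) as [B2 B4].
        unfold CDerive_n; rewrite A2, A4, B2, B4.
        destruct (plane_u s eps N t x) as [a b]; unfold om, dispersion.
        apply injective_projections; simpl; ring.
      * rewrite !Derive_n_const.
        rewrite (Derive_n_ext _ (fun _ => Rpower (jb N) (- s) ^ 2))
          by (intros; rewrite plane_wave_modulus; auto).
        rewrite Derive_n_const; ring.
  - intros x; split; [|auto]; unfold plane_u, plane_u0; f_equal; f_equal; ring.
Qed.

Lemma plane_wave_unique s eps N :
  is_the_classical_solution eps (plane_u0 s N) (fun _ => 0) (fun _ => 0)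
    (plane_wave s eps N).
Proof.
  split; [apply plane_wave_classical|].
  intros z Hz.
  assert (sol := classical_solution_real _ _ _ _ _ Hz).
  assert (wave := classical_solution_real _ _ _ _ _ (plane_wave_classical s eps N)).
  set (pw := plane_wave s eps N) in *.
  assert (Eu : forall t x, 0 <= t -> tu z t x = tu pw t x /\ tn z t x = 0).
  { assert (In : forall x, tu z 0 x = tu pw 0 x /\ tn z 0 x = 0 /\ tv z 0 x = 0).
    { intros x; destruct Hz as (_ & _ & _ & _ & _ & _ & _ & Hin).
      destruct (plane_wave_classical s eps N) as (_ & _ & _ & _ & _ & _ & _ & Hin').
      destruct (Hin x) as (-> & -> & ->); destruct (Hin' x) as (E & _ & _).
      unfold pw; rewrite E; auto. }
    intros t x Ht.
    destruct (periodic_representative x) as [y [Hy Hrep]].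
    destruct (proj1 Hz t Ht) as (Pu & Pn & _).
    destruct (proj1 (plane_wave_classical s eps N) t Ht) as (Pw & _ & _).
    rewrite (Hrep _ _ Pu), (Hrep _ _ Pn), (Hrep _ (tu pw t) Pw).
    destruct (real_solution_unique eps (dispersion eps N) (Rpower (jb N) (- s) ^ 2)
      _ _ _ _ _ _ sol wave) with (t := t) (x := y) as (E1 & E2 & E3); auto.
    - intros r w; unfold ell, re_part, frozen.
      destruct (cosine_derivative_even _ _ _ _ (plane_u_re s eps N (Rmax 0 r)) w) as [A2 A4].
      unfold pw, plane_wave; cbn [tu]; rewrite A2, A4; unfold dispersion; ring.
    - intros r w; unfold ell, im_part, frozen.
      destruct (cosine_derivative_even _ _ _ _ (plane_u_im s eps N (Rmax 0 r)) w) as [A2 A4].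
      unfold pw, plane_wave; cbn [tu]; rewrite A2, A4; unfold dispersion; ring.
    - intros r w. rewrite <- (plane_wave_modulus s eps N (Rmax 0 r) w), Cmod2_alt.
      unfold re_part, im_part, frozen; simpl tu; ring.
    - intros w; unfold re_part; rewrite !frozen_pos by lra; rewrite (proj1 (In w)); auto.
    - intros w; unfold im_part; rewrite !frozen_pos by lra; rewrite (proj1 (In w)); auto.
    - intros w; rewrite frozen_pos by lra; apply In.
    - intros w; rewrite frozen_pos by lra; apply In.
    - unfold re_part in E1; unfold im_part in E2; rewrite !frozen_pos in E3 by auto.
      rewrite 2!frozen_pos in E1 by auto; rewrite 2!frozen_pos in E2 by auto.
      split; auto. apply injective_projections; [exact E1|exact E2]. }
  intros t x Ht; destruct (Eu t x Ht) as [E1 E2]; split; [auto|split; [auto|]].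
  simpl tv; destruct (Rle_lt_or_eq_dec 0 t Ht) as [Hpos|<-].
  - destruct Hz as (_ & _ & _ & _ & _ & Hn & _ & _).
    assert (D := is_tderive_is_derive _ _ _ Hpos (Hn t x Ht)).
    rewrite <- (is_derive_unique _ _ _ D).
    rewrite (Derive_ext_loc _ (fun _ => 0)); [apply Derive_const|].
    apply filter_imp with (2 := locally_pos t Hpos); intros r Hr; apply Eu; lra.
  - destruct Hz as (_ & _ & _ & _ & _ & _ & _ & Hin); apply Hin.
Qed.

(** * Fourier coefficients of a single mode *)

Definition cont_C (f : R -> C) : Prop :=
  cont1 (fun x => Re (f x)) /\ cont1 (fun x => Im (f x)).

Lemma cont_C_mult f g : cont_C f -> cont_C g -> cont_C (fun x => (f x * g x)%C).
Proof.
  intros [F1 F2] [G1 G2]; split; unfold Re, Im in *; simpl; cont.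
Qed.

Lemma RInt_C (f : R -> C) : cont_C f ->
  RInt (V := C_R_CompleteNormedModule) f 0 (2 * PI)
  = (circle_int (fun x => Re (f x)), circle_int (fun x => Im (f x))).
Proof.
  intros [F1 F2]; apply (is_RInt_unique (V := C_R_CompleteNormedModule)).
  apply (is_RInt_fct_extend_pair (U := R_NormedModule) (V := R_NormedModule) f);
    apply (RInt_correct (V := R_CompleteNormedModule)), ex_circle; auto.
Qed.

Lemma test_function_cont phi : test_function phi -> cont_C phi.
Proof.
  intros [_ Hphi]; split; intros x; apply (ex_derive_continuous (V := R_NormedModule));
    apply (Hphi 1%nat x).
Qed.

Lemma cis_test_function k : test_function (fun x => cis (IZR k * x)).
Proof.
  split.
  - intros x; rewrite <- (Rplus_0_l (IZR k * x)), <- (cis_mode_periodic k 0 x).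
    f_equal; ring.
  - intros j x; split.
    + apply (ex_derive_n_ext (fun y => 1 * cos (IZR k * y + 0))).
      * intros y; unfold cis, Re; simpl fst; rewrite Rplus_0_r; ring.
      * apply cosine_derivatives.
    + apply (ex_derive_n_ext (fun y => 1 * cos (IZR k * y + - (PI / 2)))).
      * intros y; unfold cis, Im; simpl snd. rewrite <- sin_shift; unfold Rminus; ring.
      * apply cosine_derivatives.
Qed.

(** The function that [hat] evaluates at, in the syntactic form used there. *)
Lemma hat_character k : test_function (fun x => cis (- (IZR k * x))).
Proof.
  destruct (cis_test_function (- k)) as [P D]; rewrite opp_IZR in P, D.
  assert (E : forall x, - (IZR k * x) = - IZR k * x) by (intros; ring).
  split.
  - intros x; rewrite !E; apply P.
  - intros j x; split; [apply (ex_derive_n_ext (fun y => Re (cis (- IZR k * y))))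
                       |apply (ex_derive_n_ext (fun y => Im (cis (- IZR k * y))))];
      try apply D; intros y; rewrite E; reflexivity.
Qed.

Lemma circle_cis m : RInt (V := C_R_CompleteNormedModule) (fun x => cis (IZR m * x)) 0 (2 * PI)
  = RtoC (if Z.eq_dec m 0 then 2 * PI else 0).
Proof.
  rewrite RInt_C by apply test_function_cont, cis_test_function.
  unfold cis, Re, Im; simpl.
  destruct (Z.eq_dec m 0) as [->|Hm].
  - rewrite (circle_ext _ (fun _ => 1)), (circle_ext (fun x => sin _) (fun _ => 0)).
    + rewrite circle_zero; unfold circle_int; rewrite RInt_const.
      unfold scal; simpl; unfold mult; simpl; unfold RtoC; f_equal; ring.
    + intros x; rewrite Rmult_0_l; apply sin_0.
    + intros x; rewrite Rmult_0_l; apply cos_0.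
  - assert (Hk : IZR m <> 0) by (apply eq_IZR_contrapositive; auto).
    assert (P := periodic_Z cis m 0 cis_periodic).
    rewrite Rplus_0_l in P; unfold cis in P; injection P as Pc Ps.
    unfold RtoC; f_equal; apply is_RInt_unique.
    + replace 0 with (minus (/ IZR m * sin (IZR m * (2 * PI))) (/ IZR m * sin (IZR m * 0))) at 2.
      2:{ rewrite Ps, Rmult_0_r; apply Rminus_diag. }
      apply (is_RInt_derive (V := R_CompleteNormedModule) (fun x => / IZR m * sin (IZR m * x))).
      * intros x _; auto_derive; auto; field; auto.
      * intros x _; apply (ex_derive_continuous (V := R_NormedModule)); auto_derive; auto.
    + replace 0 with (minus (- / IZR m * cos (IZR m * (2 * PI))) (- / IZR m * cos (IZR m * 0))) at 2.
      2:{ rewrite Pc, Rmult_0_r; apply Rminus_diag. }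
      apply (is_RInt_derive (V := R_CompleteNormedModule) (fun x => - / IZR m * cos (IZR m * x))).
      * intros x _; auto_derive; auto; field; auto.
      * intros x _; apply (ex_derive_continuous (V := R_NormedModule)); auto_derive; auto.
Qed.

Lemma RInt_C_scal (z : C) f : cont_C f ->
  RInt (V := C_R_CompleteNormedModule) (fun x => (z * f x)%C) 0 (2 * PI)
  = (z * RInt (V := C_R_CompleteNormedModule) f 0 (2 * PI))%C.
Proof.
  intros Hf; destruct Hf as [F1 F2].
  rewrite (RInt_C f) by (split; auto).
  rewrite RInt_C by (apply (cont_C_mult (fun _ => z)); [split; cont|split; auto]).
  unfold Cmult; simpl; f_equal; unfold Re, Im in *; simpl.
  - rewrite circle_minus, !circle_scal; cont.
  - rewrite circle_plus, !circle_scal; cont.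
Qed.

Definition single_mode (N : Z) (z : C) (T : functional) : Prop :=
  forall k, hat T k = if Z.eq_dec k N then z else RtoC 0.

Lemma single_mode_embed N z f : (forall x, f x = (z * cis (IZR N * x))%C) ->
  single_mode N z (embed f).
Proof.
  intros E k; unfold hat, embed; assert (Hp := two_pi_pos).
  rewrite (RInt_ext (V := C_R_CompleteNormedModule) _ (fun x => (z * cis (IZR (N - k) * x))%C)).
  - rewrite RInt_C_scal by apply test_function_cont, cis_test_function.
    rewrite circle_cis.
    destruct (Z.eq_dec k N) as [->|Hk].
    + rewrite Z.sub_diag; simpl.
      apply injective_projections; unfold Cmult, RtoC; simpl; field; lra.
    + destruct (Z.eq_dec (N - k) 0); [lia|].
      apply injective_projections; unfold Cmult, RtoC; simpl; ring.
  - intros x _; change (f x * cis (- (IZR k * x)) = z * cis (IZR (N - k) * x))%C.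
    rewrite E, minus_IZR, Rmult_minus_distr_r.
    unfold Rminus; rewrite cis_plus; ring.
Qed.

Lemma single_mode_feq N z T S : feq T S -> single_mode N z S -> single_mode N z T.
Proof. intros E HS k; rewrite <- HS; unfold hat; rewrite E; auto using hat_character. Qed.

Lemma single_mode_sub N z w T S : single_mode N z T -> single_mode N w S ->
  single_mode N (z - w) (fsub T S).
Proof.
  intros HT HS k.
  replace (hat (fsub T S) k) with (hat T k - hat S k)%C by (unfold hat, fsub; ring).
  rewrite HT, HS; destruct (Z.eq_dec k N); ring.
Qed.

Lemma is_series_single (a : nat -> R) m : (forall n, n <> m -> a n = 0) -> is_series a (a m).
Proof.
  intros Ha.
  assert (E : forall n, sum_n a n = if le_dec m n then a m else 0).
  { induction n as [|n IH].
    - rewrite sum_O; destruct (le_dec m 0); [f_equal; lia|apply Ha; lia].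
    - rewrite sum_Sn, IH; unfold plus; simpl.
      destruct (le_dec m n), (le_dec m (S n)); try lia.
      + rewrite (Ha (S n)) by lia; ring.
      + replace (S n) with m by lia; ring.
      + rewrite (Ha (S n)) by lia; ring. }
  apply (filterlim_ext_loc (fun _ => a m)); [|apply filterlim_const].
  exists m; intros n Hn; rewrite E; destruct (le_dec m n); auto; lia.
Qed.

Lemma sobolev_single_mode r N z T : N <> 0%Z -> single_mode N z T ->
  is_series (sobolev_term r T) ((Rpower (jb N) r * Cmod z) ^ 2).
Proof.
  intros HN HT.
  assert (Hz : forall k, k <> N -> sobolev_coef r T k = 0).
  { intros k Hk; unfold sobolev_coef; rewrite HT.
    destruct (Z.eq_dec k N); [contradiction|]. rewrite Cmod_0; ring. }
  assert (HNc : sobolev_coef r T N = (Rpower (jb N) r * Cmod z) ^ 2).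
  { unfold sobolev_coef; rewrite HT; destruct (Z.eq_dec N N); [auto|contradiction]. }
  replace ((Rpower (jb N) r * Cmod z) ^ 2) with (sobolev_term r T (Z.abs_nat N)).
  - apply is_series_single; intros n Hn; destruct n as [|n]; simpl; [apply Hz; lia|].
    rewrite !Hz by lia; ring.
  - rewrite <- HNc; unfold sobolev_term.
    destruct (Z.abs_nat N) as [|n] eqn:En; [lia|].
    destruct (Z.abs_spec N) as [[P E]|[P E]].
    + rewrite (Hz (- Z.of_nat (S n))%Z) by lia.
      replace (Z.of_nat (S n)) with N by lia; ring.
    + rewrite (Hz (Z.of_nat (S n))) by lia.
      replace (- Z.of_nat (S n))%Z with N by lia; ring.
Qed.

Lemma Hs_norm_single_mode r N z T : N <> 0%Z -> single_mode N z T ->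
  Hs_norm r T = Rpower (jb N) r * Cmod z.
Proof.
  intros HN HT; unfold Hs_norm.
  rewrite (is_series_unique _ _ (sobolev_single_mode r N z T HN HT)).
  apply sqrt_pow2, Rmult_le_pos; [left; apply Rpower_pos|apply Cmod_ge_0].
Qed.

Lemma distribution_embed f B : cont_C f -> (forall x, Cmod (f x) <= B) ->
  distribution (embed f).
Proof.
  intros Hf HB; split.
  - intros a phi psi Hphi Hpsi.
    assert (C1 := cont_C_mult _ _ Hf (test_function_cont _ Hphi)).
    assert (C2 := cont_C_mult _ _ Hf (test_function_cont _ Hpsi)).
    unfold embed; rewrite <- RInt_C_scal by auto.
    rewrite <- (RInt_plus (V := C_R_CompleteNormedModule)).
    + apply (RInt_ext (V := C_R_CompleteNormedModule)); intros x _.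
      change (f x * (a * phi x + psi x) = a * (f x * phi x) + f x * psi x)%C; ring.
    + destruct C1 as [F1 F2].
      destruct (cont_C_mult (fun _ => a) (fun x => (f x * phi x)%C)) as [G1 G2];
        [split; cont|split; auto|].
      apply (ex_RInt_fct_extend_pair (U := R_NormedModule) (V := R_NormedModule));
        apply ex_circle; auto.
    + destruct C2 as [F1 F2].
      apply (ex_RInt_fct_extend_pair (U := R_NormedModule) (V := R_NormedModule));
        apply ex_circle; auto.
  - exists 0%nat, (2 * (2 * PI * B)); intros phi Hphi M HM.
    assert (Hp := two_pi_pos).
    destruct (cont_C_mult _ _ Hf (test_function_cont _ Hphi)) as [F1 F2].
    assert (Hpt : forall x, Cmod (f x * phi x) <= B * M).
    { intros x; rewrite Cmod_mult; apply Rmult_le_compat; try apply Cmod_ge_0; auto.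
      rewrite (surjective_pairing (phi x)); apply (HM 0%nat x); auto. }
    unfold embed; rewrite RInt_C by (split; auto).
    assert (I1 : Rabs (circle_int (fun x => Re (f x * phi x)%C)) <= (2 * PI - 0) * (B * M)).
    { apply abs_RInt_le_const; [lra|apply ex_circle; auto|].
      intros x _; apply Rle_trans with (2 := Hpt x), re_le_Cmod. }
    assert (I2 : Rabs (circle_int (fun x => Im (f x * phi x)%C)) <= (2 * PI - 0) * (B * M)).
    { apply abs_RInt_le_const; [lra|apply ex_circle; auto|].
      intros x _; apply Rle_trans with (2 := Hpt x).
      apply Rle_trans with (2 := Rmax_Cmod _), Rmax_r. }
    apply Rle_trans with (1 := Cmod_2Rmax _); simpl.
    assert (S2 : sqrt 2 <= 2).
    { rewrite <- (sqrt_pow2 2) at 2 by lra; apply sqrt_le_1; lra. }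
    apply Rle_trans with (2 * ((2 * PI - 0) * (B * M))); [|lra].
    apply Rmult_le_compat; [apply sqrt_pos| |auto|apply Rmax_lub; auto].
    apply Rle_trans with (2 := Rmax_l _ _), Rabs_pos.
Qed.

Lemma in_Hs_mode r N z f : N <> 0%Z -> (forall x, f x = (z * cis (IZR N * x))%C) ->
  in_Hs r (embed f).
Proof.
  intros HN E; split.
  - apply (distribution_embed f (Cmod z)).
    + destruct (test_function_cont _ (cis_test_function N)) as [C1 C2].
      destruct (cont_C_mult (fun _ => z) (fun x => cis (IZR N * x))) as [G1 G2];
        [split; cont|split; auto|].
      split; [apply (cont1_ext _ _ (fun x => f_equal Re (eq_sym (E x))) G1)
             |apply (cont1_ext _ _ (fun x => f_equal Im (eq_sym (E x))) G2)].
    + intros x; rewrite E, Cmod_mult, Cmod_cis; lra.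
  - eexists; apply (sobolev_single_mode r N z); auto; apply single_mode_embed, E.
Qed.

(** * Discontinuity *)

Definition plane_coef (s eps : R) (N : Z) (t : R) : C :=
  (RtoC (Rpower (jb N) (- s)) * cis (- (t * dispersion eps N)))%C.

Lemma plane_u_mode s eps N t x : plane_u s eps N t x = (plane_coef s eps N t * cis (IZR N * x))%C.
Proof.
  unfold plane_u, plane_coef, dispersion; rewrite cis_plus.
  replace (- t * (IZR N ^ 2 + eps ^ 2 * IZR N ^ 4)) with
    (- (t * (IZR N ^ 2 + eps ^ 2 * IZR N ^ 4))) by ring. ring.
Qed.

(** The zero functions carry the mode N with coefficient 0, so they are covered by
    the lemmas on single modes. *)
Lemma zero_mode N (x : R) : RtoC 0 = (RtoC 0 * cis (IZR N * x))%C.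
Proof. ring. Qed.

Lemma real_valued_zero : real_valued (embed (fun _ => RtoC 0)).
Proof.
  assert (Z0 : forall phi, embed (fun _ => RtoC 0) phi = RtoC 0).
  { intros phi; unfold embed.
    rewrite (RInt_ext (V := C_R_CompleteNormedModule) _ (fun _ => zero)).
    - rewrite RInt_const; apply (scal_zero_r (V := C_R_NormedModule)).
    - intros x _; change (RtoC 0 * phi x = RtoC 0)%C; ring. }
  intros phi _; rewrite !Z0; unfold Cconj, RtoC; simpl; f_equal; ring.
Qed.

Lemma in_D_wave D z f N : N <> 0%Z -> (forall x, f x = (z * cis (IZR N * x))%C) ->
  in_D D (state_of f (fun _ => 0) (fun _ => 0)).
Proof.
  intros HN E; split; [apply (in_Hs_mode _ N z); auto|].
  assert (Z := fun r => in_Hs_mode r N _ _ HN (zero_mode N)).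
  split; [apply Z|split; [apply real_valued_zero|split; [apply Z|apply real_valued_zero]]].
Qed.

Lemma plane_data_initial s eps N x : plane_u0 s N x = plane_u s eps N 0 x.
Proof. unfold plane_u0, plane_u; f_equal; f_equal; ring. Qed.

Lemma plane_data_in_D D s N : N <> 0%Z -> in_D D (plane_data s N).
Proof.
  intros HN; apply (in_D_wave D (plane_coef s 0 N 0) _ N); auto.
  intros x; rewrite <- plane_u_mode; apply plane_data_initial.
Qed.

Lemma plane_wave_in_D D s eps N t : N <> 0%Z -> in_D D (traj_state (plane_wave s eps N) t).
Proof.
  intros HN; apply (in_D_wave D (plane_coef s eps N t) _ N); auto.
  intros x; apply plane_u_mode.
Qed.

(** Two waves with the same data differ by their relative phase, since the
    weights of the norm and of the amplitude cancel. *)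
Lemma plane_coef_distance s eps eps0 N t :
  Rpower (jb N) s * Cmod (plane_coef s eps N t - plane_coef s eps0 N t)
  = Cmod (RtoC 1 - cis (t * (eps ^ 2 - eps0 ^ 2) * IZR N ^ 4))%C.
Proof.
  assert (E : (plane_coef s eps N t - plane_coef s eps0 N t
    = RtoC (Rpower (jb N) (- s)) * cis (- (t * dispersion eps N))
      * (RtoC 1 - cis (t * (eps ^ 2 - eps0 ^ 2) * IZR N ^ 4)))%C).
  { unfold plane_coef, dispersion.
    replace (- (t * (IZR N ^ 2 + eps0 ^ 2 * IZR N ^ 4))) with
      (- (t * (IZR N ^ 2 + eps ^ 2 * IZR N ^ 4)) + t * (eps ^ 2 - eps0 ^ 2) * IZR N ^ 4) by ring.
    rewrite cis_plus; ring. }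
  rewrite E, !Cmod_mult, Cmod_cis, Cmod_R, Rabs_pos_eq by (left; apply Rpower_pos).
  rewrite Rmult_1_r, <- Rmult_assoc, <- Rpower_plus, Rplus_opp_r.
  unfold Rpower; rewrite Rmult_0_l, exp_0; ring.
Qed.

Lemma sup_time_ext f g : (forall t, 0 <= t -> f t = g t) -> sup_time f = sup_time g.
Proof.
  intros E; apply Lub_Rbar_eqset; intros r; split; intros (t & Ht & ->); exists t; split; auto.
  symmetry; auto.
Qed.

(** The phases are opposite at the time [PI / (|eps^2 - eps0^2| N^4)]. *)
Lemma sup_relative_phase eps eps0 N : 0 <= eps -> 0 <= eps0 -> eps <> eps0 -> N <> 0%Z ->
  sup_time (fun t => Cmod (RtoC 1 - cis (t * (eps ^ 2 - eps0 ^ 2) * IZR N ^ 4))%C) = Finite 2.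
Proof.
  intros He He0 Hne HN; apply is_lub_Rbar_unique; split.
  - intros r (t & _ & ->); simpl.
    apply Rle_trans with (1 := Cmod_triangle _ _).
    rewrite Cmod_opp, Cmod_cis, Cmod_1; lra.
  - intros B HB.
    assert (Hk : IZR N <> 0) by (apply eq_IZR_contrapositive; auto).
    set (w := (eps ^ 2 - eps0 ^ 2) * IZR N ^ 4).
    assert (Hw : w <> 0).
    { apply Rmult_integral_contrapositive_currified; [|apply pow_nonzero; auto].
      replace (eps ^ 2 - eps0 ^ 2) with ((eps - eps0) * (eps + eps0)) by ring.
      apply Rmult_integral_contrapositive_currified; lra. }
    assert (Ha := Rabs_pos_lt w Hw).
    apply HB; exists (PI / Rabs w); split.
    + apply Rcomplements.Rdiv_le_0_compat; auto; left; apply PI_RGT_0.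
    + replace (PI / Rabs w * (eps ^ 2 - eps0 ^ 2) * IZR N ^ 4) with (PI / Rabs w * w)
        by (unfold w; ring).
      assert (E : cis (PI / Rabs w * w) = RtoC (-1)).
      { unfold cis, RtoC, Rabs; destruct (Rcase_abs w).
        - replace (PI / - w * w) with (- PI) by (field; auto).
          rewrite cos_neg, sin_neg, cos_PI, sin_PI; f_equal; ring.
        - replace (PI / w * w) with PI by (field; auto).
          rewrite cos_PI, sin_PI; reflexivity. }
      rewrite E, <- RtoC_minus, Cmod_R, Rabs_pos_eq; lra.
Qed.

Definition carries_mode (N : Z) (z : C) (d : state) : Prop :=
  single_mode N z (su d) /\ single_mode N 0 (sn d) /\ single_mode N 0 (sv d).

Lemma D_norm_modes D N z w d e : N <> 0%Z -> carries_mode N z d -> carries_mode N w e ->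
  D_norm D (state_sub d e) = Rpower (jb N) (exponent_u D) * Cmod (z - w).
Proof.
  intros HN (U1 & N1 & V1) (U2 & N2 & V2); unfold D_norm; simpl.
  assert (E0 : RtoC 0 = (RtoC 0 - RtoC 0)%C) by ring.
  rewrite (Hs_norm_single_mode _ N (z - w)%C), !(Hs_norm_single_mode _ N 0);
    auto using single_mode_sub.
  - rewrite Cmod_0; ring.
  - rewrite E0; apply single_mode_sub; auto.
  - rewrite E0; apply single_mode_sub; auto.
Qed.

(** Only the parameter is moved, not the data: at any positive distance of the
    parameters the supremum over time is 2. *)
Lemma not_continuous_at_plane_data D Phi N eps0 : data_to_solution_map D Phi ->
  0 <= eps0 -> N <> 0%Z -> ~ continuous_at D Phi (plane_data (exponent_u D) N) eps0.
Proof.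
  intros [_ HPhi] He0 HN Hcont.
  set (s := exponent_u D) in *. set (pd := plane_data s N) in *.
  assert (Hval : forall eps t, 0 <= eps -> 0 <= t ->
    carries_mode N (plane_coef s eps N t) (Phi pd eps t)).
  { intros eps t He Ht.
    destruct (HPhi pd eps (plane_u0 s N) (fun _ => 0) (fun _ => 0) (plane_wave s eps N))
      with (t := t) as (E1 & E2 & E3); auto.
    - apply plane_data_in_D; auto.
    - split; [|split]; intros phi _; reflexivity.
    - apply plane_wave_unique.
    - intros; apply plane_wave_in_D; auto.
    - split; [|split]; eapply single_mode_feq; eauto; apply single_mode_embed.
      + apply plane_u_mode.
      + apply zero_mode.
      + apply zero_mode. }
  destruct (Hcont 1 Rlt_0_1) as (delta & Hd & Hlt).
  assert (Hpd : carries_mode N (plane_coef s 0 N 0) pd).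
  { split; [|split]; apply single_mode_embed; try apply zero_mode.
    intros x; rewrite <- plane_u_mode; apply plane_data_initial. }
  specialize (Hlt pd (eps0 + delta / 2)).
  rewrite (sup_time_ext _ (fun t => Cmod (RtoC 1 -
      cis (t * ((eps0 + delta / 2) ^ 2 - eps0 ^ 2) * IZR N ^ 4))%C)) in Hlt.
  - rewrite sup_relative_phase in Hlt by (auto; lra).
    assert (F : 2 < 1); [|lra].
    apply Hlt; [apply plane_data_in_D; auto|lra| |].
    + rewrite (D_norm_modes D N _ _ pd pd HN Hpd Hpd).
      replace (plane_coef s 0 N 0 - plane_coef s 0 N 0)%C with (RtoC 0) by ring.
      rewrite Cmod_0; lra.
    + rewrite Rabs_pos_eq; lra.
  - intros t Ht.
    rewrite (D_norm_modes D N _ _ _ _ HN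
      (Hval (eps0 + delta / 2) t ltac:(lra) Ht) (Hval eps0 t He0 Ht)).
    apply plane_coef_distance.
Qed.

Theorem mainTheorem4 :
  forall (s l : R) (D : data_space), D = H0 s l \/ D = H s l ->
  (forall Phi : state -> R -> R -> state, data_to_solution_map D Phi ->
     forall eps0 : R, 0 <= eps0 ->
       ~ (forall d0 : state, in_D D d0 -> continuous_at D Phi d0 eps0) /\
       forall N : Z, N <> 0%Z ->
         in_D D (plane_data s N) /\
         ~ continuous_at D Phi (plane_data s N) eps0) /\
  (forall N : Z, N <> 0%Z ->
     (forall eps : R, 0 <= eps ->
        is_the_classical_solution eps (plane_u0 s N) (fun _ => 0) (fun _ => 0)
          (plane_wave s eps N)) /\
     (forall eps eps0 : R, 0 <= eps -> 0 <= eps0 -> eps <> eps0 ->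
        sup_time (fun t => Hs_norm s
            (embed (fun x => (plane_u s eps N t x - plane_u s eps0 N t x)%C)))
        = sup_time (fun t =>
            Cmod (RtoC 1 - cis (t * (eps ^ 2 - eps0 ^ 2) * IZR N ^ 4))%C) /\
        sup_time (fun t =>
            Cmod (RtoC 1 - cis (t * (eps ^ 2 - eps0 ^ 2) * IZR N ^ 4))%C)
        = Finite 2)).
Proof.
  intros s l D HD.
  assert (Es : exponent_u D = s) by (destruct HD as [-> | ->]; reflexivity).
  split.
  - intros Phi HPhi eps0 He0.
    assert (Hnot : forall N, N <> 0%Z -> ~ continuous_at D Phi (plane_data s N) eps0).
    { intros N HN; rewrite <- Es; apply not_continuous_at_plane_data; auto. }
    split; [|intros N HN; split; auto using plane_data_in_D].
    intros Hall; apply (Hnot 1%Z); [lia|apply Hall, plane_data_in_D; lia].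
  - intros N HN; split; [intros; apply plane_wave_unique|].
    intros eps eps0 He He0 Hne; split; [|apply sup_relative_phase; auto].
    apply sup_time_ext; intros t _.
    rewrite (Hs_norm_single_mode s N (plane_coef s eps N t - plane_coef s eps0 N t)%C); auto.
    + apply plane_coef_distance.
    + apply single_mode_embed; intros x; rewrite !plane_u_mode; ring.
Qed.
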